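(* Let $E\subset\mathbb{R}^2$ be the open domain bounded by an ellipse whose ratio of major to minor semiaxis is $c\ge1$. Then \[ \max\left\{2,\ \frac{2\sqrt{c^2-1}\,\arcsin\sqrt{1-\frac{1}{c^2}}}{\log(2c^2-1)}\right\}\le A_E\le 2c^4, \] where for $c=1$ the second quantity inside the maximum is omitted.
   Context: For a domain $G\subsetneq\mathbb{R}^n$ let $d_G(x)=d(x,\partial G)$. The quasihyperbolic distance is $k_G(x,y)=\inf_\gamma\int_\gamma\frac{|dx|}{d_G(x)}$ over rectifiable curves $\gamma\subset G$ joining $x$ and $y$. The distance ratio metric is $j_G(x,y)=\log\left(1+\frac{|x-y|}{\min\{d_G(x),d_G(y)\}}\right)$. The uniformity constant is $A_G=\inf\{A\ge1: k_G(x,y)\le A\,j_G(x,y)\text{ for all }x,y\in G\}$ (with $\inf\emptyset=+\infty$). *)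

(* Defs.v *)
From Stdlib Require Import Reals Lra ClassicalEpsilon.
Open Scope R_scope.

Definition pt := (R * R)%type.
Definition edist (p q : pt) : R :=
  sqrt ((fst p - fst q) ^ 2 + (snd p - snd q) ^ 2).

Definition is_glb (S : R -> Prop) (m : R) : Prop :=
  (forall x, S x -> m <= x) /\
  (forall m', (forall x, S x -> m' <= x) -> m' <= m).
Definition is_sup (S : R -> Prop) (m : R) : Prop :=
  (forall x, S x -> x <= m) /\
  (forall m', (forall x, S x -> x <= m') -> m <= m').

(* Rinf S is the infimum when it exists (S nonempty, bounded below); else 0. *)
Definition Rinf (S : R -> Prop) : R :=
  match excluded_middle_informative (exists m, is_glb S m) with
  | left h => proj1_sig (constructive_indefinite_description _ h)
  | right _ => 0
  end.
(* Rsup S is the supremum when it exists (S nonempty, bounded above); else 0. *)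
Definition Rsup (S : R -> Prop) : R :=
  match excluded_middle_informative (exists m, is_sup S m) with
  | left h => proj1_sig (constructive_indefinite_description _ h)
  | right _ => 0
  end.

Definition boundary (G : pt -> Prop) (z : pt) : Prop :=
  forall eps, 0 < eps ->
    (exists w, G w /\ edist w z < eps) /\ (exists w, ~ G w /\ edist w z < eps).

Definition dG (G : pt -> Prop) (x : pt) : R :=
  Rinf (fun r => exists z, boundary G z /\ r = edist x z).

Definition curve_continuous (g : R -> pt) (s t : R) : Prop :=
  forall u, s <= u <= t -> forall eps, 0 < eps -> exists delta, 0 < delta /\
    forall v, s <= v <= t -> Rabs (v - u) < delta -> edist (g v) (g u) < eps.

Definition partition (s t : R) (n : nat) (p : nat -> R) : Prop :=
  p 0%nat = s /\ p n = t /\ forall i, (i < n)%nat -> p i <= p (S i).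

Fixpoint sumn_R (n : nat) (f : nat -> R) : R :=
  match n with O => 0 | S k => sumn_R k f + f k end.

Definition polygon_lengths (g : R -> pt) (s t : R) (L : R) : Prop :=
  exists n p, partition s t n p /\
    L = sumn_R n (fun i => edist (g (p (S i))) (g (p i))).

Definition rectifiable (g : R -> pt) (s t : R) : Prop :=
  exists M, forall L, polygon_lengths g s t L -> L <= M.

Definition curve_length (g : R -> pt) (s t : R) : R :=
  Rsup (polygon_lengths g s t).

(* The line integral  \int_g f |dx|  of a nonnegative continuous f, defined as
   the (lower Darboux-)Stieltjes integral of f o g with respect to arc length:
   supremum over partitions of  sum_i (inf_{[p_i,p_{i+1}]} f o g) * l(g|[p_i,p_{i+1}]). *)
Definition lower_sums (f : pt -> R) (g : R -> pt) (s t : R) (v : R) : Prop :=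
  exists n p, partition s t n p /\
    v = sumn_R n (fun i =>
          Rinf (fun y => exists u, p i <= u <= p (S i) /\ y = f (g u))
          * curve_length g (p i) (p (S i))).

Definition line_integral (f : pt -> R) (g : R -> pt) (s t : R) : R :=
  Rsup (lower_sums f g s t).

Definition kG (G : pt -> Prop) (x y : pt) : R :=
  Rinf (fun v => exists (g : R -> pt) (s t : R),
          s <= t /\ g s = x /\ g t = y /\
          curve_continuous g s t /\ rectifiable g s t /\
          (forall u, s <= u <= t -> G (g u)) /\
          v = line_integral (fun z => / dG G z) g s t).

Definition jG (G : pt -> Prop) (x y : pt) : R :=
  ln (1 + edist x y / Rmin (dG G x) (dG G y)).

(** The set of admissible constants; A_G is its infimum (+oo if empty). *)
Definition uniformity_set (G : pt -> Prop) (A : R) : Prop :=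
  1 <= A /\ forall x y, G x -> G y -> kG G x y <= A * jG G x y.

Definition ellipse_domain (a b x0 y0 th : R) (p : pt) : Prop :=
  let X := fst p - x0 in let Y := snd p - y0 in
  ((cos th * X + sin th * Y) / a) ^ 2 + ((- sin th * X + cos th * Y) / b) ^ 2 < 1.

(* Main.v *)
(* Affine coordinates [disc_coord] carry the ellipse to the unit disc.  Upper
   bound: pull back to the ellipse the hyperbolic geodesic of the disc; since
   [1 / (1 - |z|) <= 2 / (1 - |z|^2)], its quasihyperbolic length is at most
   [c] times a hyperbolic distance, which is at most [2 j] in the disc, and
   concavity of the logarithm loses another factor [c] when [j] is transported
   to the ellipse.  This gives [2 c^2 <= 2 c^4].

   Lower bounds: if [dG <= D], where [D] depends only on one coordinate, then
   the quasihyperbolic distance dominates the integral of [1 / D] along that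
   coordinate.  Points of the minor axis approaching its two ends give [2]; the
   two centres of curvature of the vertices on the major axis give the second
   bound. *)

Require Import Defs.
From Stdlib Require Import Reals Lra Lia Classical ClassicalEpsilon.
Open Scope R_scope.

(** * Infima and suprema *)

(** [Rinf] and [Rsup] fall back to 0 when no extremum exists, so values of [dG], [kG] and
    [line_integral] carry information only once existence is known: [1 / dG] must be bounded along a
    curve, and [kG] needs an admissible curve. The pulled-back geodesic supplies that curve, also
    for the lower bounds. No derivative of a curve is available, so integrals are compared through
    short chords. For an upper bound, a lower bound of the density at both ends times the chord is
    at most [1 + eps] times the increment of a primitive. For a lower bound, the smaller end value
    of [D] times the increment of a potential is at most the chord. For the geodesic the first
    comparison rests on an exact identity, the invariance of |z - z'|^2 / ((1 - |z|^2) (1 - |z'|^2))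
    under automorphisms of the disc. [D] must be Lipschitz in order to be nearly constant on short
    arcs. Hence the coordinate along the major axis is clamped between the two centres of curvature,
    where the square root stays away from its singularity. *)

Lemma glb_exists (S : R -> Prop) (l : R) :
  (exists x, S x) -> (forall x, S x -> l <= x) -> exists m, is_glb S m.
Proof.
  intros [x0 Hx0] Hl.
  destruct (completeness (fun y => S (- y))) as [m [Hub Hlub]].
  - exists (- l). intros y Hy. specialize (Hl _ Hy). lra.
  - exists (- x0). rewrite Ropp_involutive. exact Hx0.
  - exists (- m). split.
    + intros x Hx. enough (- x <= m) by lra. apply Hub.
      rewrite Ropp_involutive. exact Hx.
    + intros m' Hm'. enough (m <= - m') by lra. apply Hlub.
      intros y Hy. specialize (Hm' _ Hy). lra.
Qed.

Lemma sup_exists (S : R -> Prop) (M : R) :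
  (exists x, S x) -> (forall x, S x -> x <= M) -> exists m, is_sup S m.
Proof.
  intros [x0 Hx0] HM.
  destruct (completeness S) as [m [Hub Hlub]].
  - exists M. exact HM.
  - exists x0. exact Hx0.
  - exists m. split; [exact Hub | exact Hlub].
Qed.

Lemma Rinf_is_glb (S : R -> Prop) (l : R) :
  (exists x, S x) -> (forall x, S x -> l <= x) -> is_glb S (Rinf S).
Proof.
  intros Hne Hl. unfold Rinf.
  destruct (excluded_middle_informative _) as [h | h].
  - destruct (constructive_indefinite_description _ h) as [m Hm]. exact Hm.
  - destruct h. exact (glb_exists S l Hne Hl).
Qed.

Lemma Rsup_is_sup (S : R -> Prop) (M : R) :
  (exists x, S x) -> (forall x, S x -> x <= M) -> is_sup S (Rsup S).
Proof.
  intros Hne HM. unfold Rsup.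
  destruct (excluded_middle_informative _) as [h | h].
  - destruct (constructive_indefinite_description _ h) as [m Hm]. exact Hm.
  - destruct h. exact (sup_exists S M Hne HM).
Qed.

Lemma Rinf_nonneg (S : R -> Prop) : (forall x, S x -> 0 <= x) -> 0 <= Rinf S.
Proof.
  intros H. unfold Rinf.
  destruct (excluded_middle_informative _) as [h | h]; [| lra].
  destruct (constructive_indefinite_description _ h) as [m Hm]. simpl.
  apply Hm. exact H.
Qed.

Lemma Rsup_nonneg (S : R -> Prop) :
  (exists x, S x /\ 0 <= x) -> 0 <= Rsup S.
Proof.
  intros [x [Hx Hx0]]. unfold Rsup.
  destruct (excluded_middle_informative _) as [h | h]; [| lra].
  destruct (constructive_indefinite_description _ h) as [m Hm]. simpl.
  destruct Hm as [Hm _]. specialize (Hm _ Hx). lra.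
Qed.

(* A property of intervals that is additive and holds near every point holds
   on the whole interval: this replaces every compactness argument below. *)
Lemma interval_creeping (C : R -> R -> Prop) (s t : R) :
  s <= t ->
  (forall u v w, s <= u -> u <= v -> v <= w -> w <= t ->
     C u v -> C v w -> C u w) ->
  (forall m, s <= m <= t -> exists delta, 0 < delta /\
     forall u v, s <= u -> u <= m -> m <= v -> v <= t -> v - u < delta -> C u v) ->
  C s t.
Proof.
  intros Hst Hadd Hloc.
  destruct (completeness (fun u => s <= u <= t /\ C s u)) as [m [Hub Hlub]].
  - exists t. intros u [Hu _]. lra.
  - exists s. split; [lra |].
    destruct (Hloc s) as [d [Hd H]]; [lra |]. apply H; lra.
  - assert (Hsm : s <= m).
    { apply Hub. split; [lra |].
      destruct (Hloc s) as [d [Hd H]]; [lra |]. apply H; lra. }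
    assert (Hmt : m <= t) by (apply Hlub; intros u [Hu _]; lra).
    destruct (Hloc m) as [d [Hd H]]; [lra |].
    assert (Hu : exists u, (s <= u <= t /\ C s u) /\ m - d / 2 < u).
    { apply NNPP. intros Hno.
      enough (m <= m - d / 2) by lra. apply Hlub. intros u Hu.
      apply Rnot_lt_le. intros Hlt. apply Hno. exists u. split; assumption. }
    destruct Hu as [u [Hu Hmu]].
    assert (u <= m) by (apply Hub; exact Hu). destruct Hu as [Hu HC].
    assert (Hext : forall v, m <= v -> v <= t -> v < m + d / 2 -> C s v).
    { intros v H1 H2 H3. apply Hadd with u; try lra; [exact HC |].
      apply H; lra. }
    destruct (Req_dec m t) as [-> | Hne]; [apply Hext; lra |].
    (* If [m < t], the local property at [m] carries [C s] beyond [m], against the choice of [m] as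
       an upper bound. *)
    exfalso. set (v := Rmin t (m + d / 4)).
    assert (m < v /\ v <= t /\ v <= m + d / 4).
    { unfold v. split; [apply Rmin_glb_lt; lra |].
      split; [apply Rmin_l | apply Rmin_r]. }
    enough (v <= m) by lra. apply Hub. split; [lra |]. apply Hext; lra.
Qed.

(** * The Euclidean distance *)

Lemma edist_nonneg (p q : pt) : 0 <= edist p q.
Proof. apply sqrt_pos. Qed.

Lemma edist_sqr (p q : pt) :
  edist p q ^ 2 = (fst p - fst q) ^ 2 + (snd p - snd q) ^ 2.
Proof.
  unfold edist. rewrite pow2_sqrt; [reflexivity |].
  apply Rplus_le_le_0_compat; apply pow2_ge_0.
Qed.

Lemma edist_sym (p q : pt) : edist p q = edist q p.
Proof. unfold edist. f_equal. ring. Qed.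

Lemma le_of_sqr_le (x y : R) : 0 <= y -> x ^ 2 <= y ^ 2 -> x <= y.
Proof. intros. nra. Qed.

Lemma edist_triangle (p q r : pt) : edist p r <= edist p q + edist q r.
Proof.
  pose proof (edist_nonneg p q). pose proof (edist_nonneg q r).
  apply le_of_sqr_le; [lra |].
  pose proof (edist_sqr p q) as Hpq. pose proof (edist_sqr q r) as Hqr.
  rewrite edist_sqr.
  set (a1 := fst p - fst q) in *. set (a2 := snd p - snd q) in *.
  set (b1 := fst q - fst r) in *. set (b2 := snd q - snd r) in *.
  replace (fst p - fst r) with (a1 + b1) by (unfold a1, b1; ring).
  replace (snd p - snd r) with (a2 + b2) by (unfold a2, b2; ring).
  assert (a1 * b1 + a2 * b2 <= edist p q * edist q r).
  { apply le_of_sqr_le; [nra |].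
    rewrite Rpow_mult_distr, Hpq, Hqr.
    pose proof (pow2_ge_0 (a1 * b2 - a2 * b1)). nra. }
  nra.
Qed.

(** * Partitions, length and line integrals *)

(** Polygon lengths and lower sums are both convertible with instances of this sum, so that
    concatenation and superadditivity are proved once for all interval functions [F]. *)
Definition partition_sum (F : R -> R -> R) (n : nat) (p : nat -> R) : R :=
  sumn_R n (fun i => F (p i) (p (S i))).

Lemma sumn_R_ext (n : nat) (f g : nat -> R) :
  (forall i, (i < n)%nat -> f i = g i) -> sumn_R n f = sumn_R n g.
Proof.
  induction n as [| n IH]; intros H; simpl; [reflexivity |].
  rewrite IH, (H n); [reflexivity | lia |]. intros i Hi. apply H. lia.
Qed.

Lemma sumn_R_le (n : nat) (f g : nat -> R) :
  (forall i, (i < n)%nat -> f i <= g i) -> sumn_R n f <= sumn_R n g.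
Proof.
  induction n as [| n IH]; intros H; simpl; [lra |].
  assert (f n <= g n) by (apply H; lia).
  assert (sumn_R n f <= sumn_R n g) by (apply IH; intros; apply H; lia). lra.
Qed.

Lemma sumn_R_scal (n : nat) (c : R) (f : nat -> R) :
  sumn_R n (fun i => c * f i) = c * sumn_R n f.
Proof. induction n as [| n IH]; simpl; [ring |]. rewrite IH. ring. Qed.

Lemma sumn_R_add (n m : nat) (f : nat -> R) :
  sumn_R (n + m) f = sumn_R n f + sumn_R m (fun i => f (n + i)%nat).
Proof.
  induction m as [| m IH]; simpl.
  - rewrite Nat.add_0_r. ring.
  - rewrite Nat.add_succ_r. simpl. rewrite IH. ring.
Qed.

Lemma partition_one (s t : R) : s <= t ->
  exists p, partition s t 1 p /\ forall F, partition_sum F 1 p = F s t.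
Proof.
  intros Hst. exists (fun i => match i with O => s | _ => t end). split.
  - repeat split. intros i Hi. replace i with 0%nat by lia. exact Hst.
  - intros F. unfold partition_sum. simpl. ring.
Qed.

Lemma partition_concat (s m t : R) (n k : nat) (p q : nat -> R) :
  partition s m n p -> partition m t k q ->
  exists r, partition s t (n + k) r /\
    forall F, partition_sum F (n + k) r = partition_sum F n p + partition_sum F k q.
Proof.
  intros [Hp0 [Hpn Hp]] [Hq0 [Hqk Hq]].
  set (r := fun i => if Nat.leb i n then p i else q (i - n)%nat).
  assert (Hr1 : forall i, (i <= n)%nat -> r i = p i).
  { intros i Hi. unfold r. apply Nat.leb_le in Hi. rewrite Hi. reflexivity. }
  assert (Hr2 : forall i, r (n + i)%nat = q i).
  { intros i. destruct i as [| i].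
    - rewrite Nat.add_0_r, Hr1 by lia. congruence.
    - unfold r. destruct (Nat.leb_spec (n + S i) n); [lia |].
      f_equal. lia. }
  exists r. split; [split; [| split] |].
  - rewrite Hr1 by lia. exact Hp0.
  - rewrite Hr2. exact Hqk.
  - intros i Hi. destruct (Nat.lt_ge_cases i n) as [H | H].
    + rewrite !Hr1 by lia. apply Hp. exact H.
    + replace i with (n + (i - n))%nat by lia. rewrite <- Nat.add_succ_r, !Hr2.
      apply Hq. lia.
  - intros F. unfold partition_sum. rewrite sumn_R_add. f_equal.
    + apply sumn_R_ext. intros i Hi. rewrite !Hr1 by lia. reflexivity.
    + apply sumn_R_ext. intros i Hi. rewrite <- Nat.add_succ_r, !Hr2. reflexivity.
Qed.

Lemma partition_mono (s t : R) (n : nat) (p : nat -> R) :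
  partition s t n p ->
  forall i j, (i <= j)%nat -> (j <= n)%nat -> p i <= p j.
Proof.
  intros [_ [_ Hp]] i j Hij. induction Hij as [| j Hij IH]; intros Hj; [lra |].
  specialize (Hp j ltac:(lia)). specialize (IH ltac:(lia)). lra.
Qed.

Lemma partition_bounds (s t : R) (n : nat) (p : nat -> R) :
  partition s t n p -> forall i, (i <= n)%nat -> s <= p i <= t.
Proof.
  intros Hp i Hi. pose proof (partition_mono s t n p Hp) as Hm.
  destruct Hp as [<- [<- _]]. split; apply Hm; lia.
Qed.

(** Induction over the prefixes of the partition. The condition [0 <= F s s] covers [n = 0], which
    forces [s = t]. *)
Lemma superadditive_partition_sum (F : R -> R -> R) (s t : R) (n : nat) (p : nat -> R) :
  0 <= F s s ->
  (forall u v w, s <= u -> u <= v -> v <= w -> w <= t -> F u v + F v w <= F u w) ->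
  partition s t n p -> partition_sum F n p <= F s t.
Proof.
  intros H0 HF Hp.
  enough (H : forall k, (k <= n)%nat -> partition_sum F k p <= F s (p k)).
  { destruct Hp as [Hs [Ht Hp]]. rewrite <- Ht. apply H. lia. }
  pose proof (partition_bounds s t n p Hp) as Hb.
  induction k as [| k IH]; intros Hk; unfold partition_sum in *; simpl.
  - replace (p 0%nat) with s; [exact H0 | symmetry; apply Hp].
  - specialize (IH ltac:(lia)).
    assert (F s (p k) + F (p k) (p (S k)) <= F s (p (S k))); [| lra].
    pose proof (Hb k ltac:(lia)). pose proof (Hb (S k) Hk).
    apply HF; try lra. apply Hp. lia.
Qed.

Lemma polygon_lengths_nonempty (g : R -> pt) (s t : R) :
  s <= t -> polygon_lengths g s t (edist (g t) (g s)).
Proof.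
  intros Hst. destruct (partition_one s t Hst) as [p [Hp HF]].
  exists 1%nat, p. split; [exact Hp |].
  symmetry. exact (HF (fun u v => edist (g v) (g u))).
Qed.

Lemma polygon_lengths_concat (g : R -> pt) (s m t L1 L2 : R) :
  polygon_lengths g s m L1 -> polygon_lengths g m t L2 ->
  polygon_lengths g s t (L1 + L2).
Proof.
  intros [n [p [Hp ->]]] [k [q [Hq ->]]].
  destruct (partition_concat _ _ _ _ _ _ _ Hp Hq) as [r [Hr HF]].
  exists (n + k)%nat, r. split; [exact Hr |].
  symmetry. exact (HF (fun u v => edist (g v) (g u))).
Qed.

(** A polygon over [[u, v]] becomes one over [[s, t]] by adding the two outer chords, which can only
    increase its length. *)
Lemma rectifiable_sub (g : R -> pt) (s t u v : R) :
  rectifiable g s t -> s <= u -> u <= v -> v <= t -> rectifiable g u v.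
Proof.
  intros [M HM] Hsu Huv Hvt. exists M. intros L HL.
  pose proof (polygon_lengths_concat _ _ _ _ _ _
    (polygon_lengths_concat _ _ _ _ _ _ (polygon_lengths_nonempty g s u Hsu) HL)
    (polygon_lengths_nonempty g v t Hvt)) as H.
  apply HM in H.
  pose proof (edist_nonneg (g u) (g s)). pose proof (edist_nonneg (g t) (g v)). lra.
Qed.

Lemma curve_length_is_sup (g : R -> pt) (s t : R) :
  s <= t -> rectifiable g s t ->
  is_sup (polygon_lengths g s t) (curve_length g s t).
Proof.
  intros Hst [M HM]. apply Rsup_is_sup with M; [| exact HM].
  eexists. apply polygon_lengths_nonempty. exact Hst.
Qed.

Lemma curve_length_ge_chord (g : R -> pt) (s t : R) :
  s <= t -> rectifiable g s t -> edist (g t) (g s) <= curve_length g s t.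
Proof.
  intros Hst Hr. apply (curve_length_is_sup g s t Hst Hr).
  apply polygon_lengths_nonempty. exact Hst.
Qed.

Lemma curve_length_nonneg (g : R -> pt) (s t : R) : s <= t -> 0 <= curve_length g s t.
Proof.
  intros Hst. apply Rsup_nonneg. exists (edist (g t) (g s)).
  split; [apply polygon_lengths_nonempty; exact Hst | apply edist_nonneg].
Qed.

Lemma curve_length_superadditive (g : R -> pt) (s m t : R) :
  s <= m -> m <= t -> rectifiable g s t ->
  curve_length g s m + curve_length g m t <= curve_length g s t.
Proof.
  intros Hsm Hmt Hr.
  destruct (curve_length_is_sup g s m) as [_ H1]; [lra | eapply rectifiable_sub; eauto; lra |].
  destruct (curve_length_is_sup g m t) as [_ H2]; [lra | eapply rectifiable_sub; eauto; lra |].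
  destruct (curve_length_is_sup g s t) as [H3 _]; [lra | exact Hr |].
  enough (curve_length g s m <= curve_length g s t - curve_length g m t) by lra.
  apply H1. intros L1 HL1.
  enough (curve_length g m t <= curve_length g s t - L1) by lra.
  apply H2. intros L2 HL2.
  pose proof (H3 _ (polygon_lengths_concat _ _ _ _ _ _ HL1 HL2)). lra.
Qed.

Definition lower_term (f : pt -> R) (g : R -> pt) (u v : R) : R :=
  Rinf (fun y => exists w, u <= w <= v /\ y = f (g w)) * curve_length g u v.

Lemma lower_sums_one (f : pt -> R) (g : R -> pt) (s t : R) :
  s <= t -> lower_sums f g s t (lower_term f g s t).
Proof.
  intros Hst. destruct (partition_one s t Hst) as [p [Hp HF]].
  exists 1%nat, p. split; [exact Hp |].
  symmetry. exact (HF (lower_term f g)).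
Qed.

Lemma lower_sums_concat (f : pt -> R) (g : R -> pt) (s m t v w : R) :
  lower_sums f g s m v -> lower_sums f g m t w -> lower_sums f g s t (v + w).
Proof.
  intros [n [p [Hp ->]]] [k [q [Hq ->]]].
  destruct (partition_concat _ _ _ _ _ _ _ Hp Hq) as [r [Hr HF]].
  exists (n + k)%nat, r. split; [exact Hr |].
  symmetry. exact (HF (lower_term f g)).
Qed.

Lemma inf_on_interval (f : pt -> R) (g : R -> pt) (u v : R) :
  (forall z, 0 <= f z) -> u <= v ->
  is_glb (fun y => exists w, u <= w <= v /\ y = f (g w))
    (Rinf (fun y => exists w, u <= w <= v /\ y = f (g w))).
Proof.
  intros Hf Huv. apply Rinf_is_glb with 0.
  - exists (f (g u)), u. split; [lra | reflexivity].
  - intros y [w [_ ->]]. apply Hf.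
Qed.

Lemma lower_term_nonneg (f : pt -> R) (g : R -> pt) (u v : R) :
  (forall z, 0 <= f z) -> u <= v -> 0 <= lower_term f g u v.
Proof.
  intros Hf Huv. apply Rmult_le_pos; [| apply curve_length_nonneg; exact Huv].
  apply Rinf_nonneg. intros y [w [_ ->]]. apply Hf.
Qed.

Lemma line_integral_nonneg (f : pt -> R) (g : R -> pt) (s t : R) :
  (forall z, 0 <= f z) -> s <= t -> 0 <= line_integral f g s t.
Proof.
  intros Hf Hst. apply Rsup_nonneg. exists (lower_term f g s t).
  split; [apply lower_sums_one; exact Hst | apply lower_term_nonneg; assumption].
Qed.

(** Each infimum is at most [M] and the lengths of the pieces add up to at most the whole length.
    This bound is what makes [line_integral] a true supremum. *)
Lemma lower_sums_bounded (f : pt -> R) (g : R -> pt) (s t M : R) :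
  (forall z, 0 <= f z) -> s <= t -> rectifiable g s t ->
  (forall u, s <= u <= t -> f (g u) <= M) ->
  forall v, lower_sums f g s t v -> v <= M * curve_length g s t.
Proof.
  intros Hf Hst Hr HM v [n [p [Hp ->]]].
  assert (HM0 : 0 <= M) by (eapply Rle_trans; [apply (Hf (g s)) | apply HM; lra]).
  apply Rle_trans with (partition_sum (fun u v => M * curve_length g u v) n p).
  - apply sumn_R_le. intros i Hi.
    pose proof (partition_bounds s t n p Hp i ltac:(lia)).
    assert (p i <= p (S i)) by (apply Hp; exact Hi).
    apply Rmult_le_compat_r; [apply curve_length_nonneg; assumption |].
    apply Rle_trans with (f (g (p i))); [| apply HM; assumption].
    apply inf_on_interval; [exact Hf | assumption |].
    exists (p i). split; [lra | reflexivity].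
  - apply (superadditive_partition_sum (fun u v => M * curve_length g u v) s t); [| | exact Hp].
    + apply Rmult_le_pos; [exact HM0 | apply curve_length_nonneg; lra].
    + intros u v w H1 H2 H3 H4. rewrite <- Rmult_plus_distr_l.
      apply Rmult_le_compat_l; [exact HM0 |].
      apply curve_length_superadditive; try lra.
      apply rectifiable_sub with s t; try lra. exact Hr.
Qed.

Lemma lower_sum_le_line_integral (f : pt -> R) (g : R -> pt) (s t M : R) :
  (forall z, 0 <= f z) -> s <= t -> rectifiable g s t ->
  (forall u, s <= u <= t -> f (g u) <= M) ->
  forall v, lower_sums f g s t v -> v <= line_integral f g s t.
Proof.
  intros Hf Hst Hr HM.
  apply (Rsup_is_sup (lower_sums f g s t) (M * curve_length g s t)).
  - eexists. apply lower_sums_one. exact Hst.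
  - exact (lower_sums_bounded f g s t M Hf Hst Hr HM).
Qed.

(** [F] plays the part of a primitive of the density along [g]. The infimum of [f] over a piece is a
    legitimate [m] for every chord inside that piece, so the comparison passes from short chords to
    all chords, then to polygons, lengths and lower sums. *)
Lemma line_integral_le (f : pt -> R) (g : R -> pt) (F : R -> R) (s t : R) :
  (forall z, 0 <= f z) -> s <= t -> rectifiable g s t ->
  (forall eps, 0 < eps -> exists delta, 0 < delta /\
     forall u v m, s <= u -> u <= v -> v <= t -> v - u < delta ->
       0 <= m -> m <= f (g u) -> m <= f (g v) ->
       m * edist (g v) (g u) <= (1 + eps) * (F v - F u)) ->
  line_integral f g s t <= F t - F s.
Proof.
  intros Hf Hst Hr HF.
  assert (Hterm : forall eps u v, 0 < eps -> s <= u -> u <= v -> v <= t ->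
            lower_term f g u v <= (1 + eps) * (F v - F u)).
  { intros eps p q Heps Hsp Hpq Hqt. unfold lower_term.
    destruct (inf_on_interval f g p q Hf Hpq) as [Hm _].
    assert (Hm0 : 0 <= Rinf (fun y => exists w, p <= w <= q /\ y = f (g w))).
    { apply Rinf_nonneg. intros y [w [_ ->]]. apply Hf. }
    set (m := Rinf _) in *.
    destruct (HF eps Heps) as [d [Hd HFd]].
    assert (Hchord : forall u v, p <= u -> u <= v -> v <= q ->
              m * edist (g v) (g u) <= (1 + eps) * (F v - F u)).
    { intros u v Hpu Huv Hvq.
      (* Short chords obey the bound by hypothesis, and the triangle inequality makes it
         additive. *)
      apply (interval_creeping
               (fun u v => m * edist (g v) (g u) <= (1 + eps) * (F v - F u)) u v Huv).
      - intros x y z _ _ _ _ H1 H2.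
        pose proof (edist_triangle (g z) (g y) (g x)). nra.
      - intros w Hw. exists d. split; [exact Hd |].
        intros x y H1 H2 H3 H4 H5. apply HFd; try lra.
        + apply Hm. exists x. split; [lra | reflexivity].
        + apply Hm. exists y. split; [lra | reflexivity]. }
    assert (Hpoly : forall L, polygon_lengths g p q L -> m * L <= (1 + eps) * (F q - F p)).
    { intros L [n [pp [Hpp ->]]].
      rewrite <- sumn_R_scal.
      pose proof (partition_bounds _ _ _ _ Hpp) as Hb.
      apply Rle_trans with (partition_sum (fun u v => (1 + eps) * (F v - F u)) n pp).
      - apply sumn_R_le. intros i Hi. pose proof (Hb i ltac:(lia)).
        pose proof (Hb (S i) ltac:(lia)).
        apply Hchord; try lra. apply Hpp. exact Hi.
      - apply (superadditive_partition_sum (fun u v => (1 + eps) * (F v - F u)) p q);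
          [lra | intros; lra | exact Hpp]. }
    destruct (curve_length_is_sup g p q Hpq) as [_ Hsup].
    { apply rectifiable_sub with s t; assumption. }
    destruct (Rle_lt_or_eq_dec 0 m Hm0) as [Hmpos | Hm00].
    - enough (curve_length g p q <= (1 + eps) * (F q - F p) / m) as H.
      { apply Rmult_le_compat_l with (r := m) in H; [| lra].
        eapply Rle_trans; [exact H |]. right. field. lra. }
      apply Hsup. intros L HL. apply Hpoly in HL.
      apply Rmult_le_reg_l with m; [exact Hmpos |].
      eapply Rle_trans; [exact HL |]. right. field. lra.
    (* Division by [m] is impossible here, but the chord bound with [m = 0] says that [F] does not
       decrease. *)
    - rewrite <- Hm00, Rmult_0_l.
      specialize (Hchord p q ltac:(lra) Hpq ltac:(lra)).
      rewrite <- Hm00, Rmult_0_l in Hchord. exact Hchord. }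
  assert (Hall : forall eps, 0 < eps -> line_integral f g s t <= (1 + eps) * (F t - F s)).
  { intros eps Heps.
    assert (Hb : forall v, lower_sums f g s t v -> v <= (1 + eps) * (F t - F s)).
    { intros v [n [p [Hp ->]]].
      pose proof (partition_bounds _ _ _ _ Hp) as Hb.
      apply Rle_trans with (partition_sum (fun u v => (1 + eps) * (F v - F u)) n p).
      - apply sumn_R_le. intros i Hi.
        pose proof (Hb i ltac:(lia)). pose proof (Hb (S i) ltac:(lia)).
        apply Hterm; try lra. apply Hp. exact Hi.
      - apply (superadditive_partition_sum (fun u v => (1 + eps) * (F v - F u)) s t);
          [lra | intros; lra | exact Hp]. }
    apply (Rsup_is_sup (lower_sums f g s t) ((1 + eps) * (F t - F s))); [| exact Hb | exact Hb].
    eexists. apply lower_sums_one. exact Hst. }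
  apply Rnot_lt_le. intros Hlt.
  pose proof (Hall 1 ltac:(lra)) as H1.
  pose proof (line_integral_nonneg f g s t Hf Hst) as H0.
  set (I := line_integral f g s t) in *. set (J := F t - F s) in *.
  assert (HJ : 0 <= J) by lra.
  (* This value of [eps] satisfies [eps * J <= (I - J) / 2]; the [+ 1] keeps the denominator
     positive when [J = 0]. *)
  pose proof (Hall ((I - J) / (2 * (J + 1))) ltac:(apply Rdiv_lt_0_compat; lra)) as H2.
  assert ((I - J) / (2 * (J + 1)) * J <= (I - J) / 2); [| lra].
  apply Rmult_le_reg_r with (2 * (J + 1)); [lra |].
  replace ((I - J) / (2 * (J + 1)) * J * (2 * (J + 1))) with ((I - J) * J) by (field; lra).
  nra.
Qed.

(** * Distance to the boundary *)

Lemma dG_is_glb (G : pt -> Prop) (p : pt) :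
  (exists z, boundary G z) ->
  is_glb (fun r => exists z, boundary G z /\ r = edist p z) (dG G p).
Proof.
  intros [z Hz]. apply Rinf_is_glb with 0.
  - exists (edist p z), z. split; [exact Hz | reflexivity].
  - intros r [w [_ ->]]. apply edist_nonneg.
Qed.

Lemma dG_nonneg (G : pt -> Prop) (p : pt) : 0 <= dG G p.
Proof. apply Rinf_nonneg. intros r [w [_ ->]]. apply edist_nonneg. Qed.

Lemma inv_dG_nonneg (G : pt -> Prop) (p : pt) : 0 <= / dG G p.
Proof.
  destruct (Rle_lt_or_eq_dec _ _ (dG_nonneg G p)) as [H | <-].
  - left. apply Rinv_0_lt_compat. exact H.
  - rewrite Rinv_0. lra.
Qed.

(** Around a point off the boundary, membership in [G] is locally constant. Were the whole segment
    free of boundary points, membership would propagate from [p] to [q]. *)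
Lemma boundary_on_segment (G : pt -> Prop) (p q : pt) :
  G p -> ~ G q -> exists z, boundary G z /\ edist p z <= edist p q.
Proof.
  intros Hp Hq. apply NNPP. intros Hno.
  set (z := fun r => (fst p + r * (fst q - fst p), snd p + r * (snd q - snd p))).
  assert (Hz : forall r r', edist (z r) (z r') = Rabs (r - r') * edist p q).
  { intros r r'.
    rewrite <- (sqrt_pow2 (edist (z r) (z r'))) by apply edist_nonneg.
    rewrite <- (sqrt_pow2 (Rabs (r - r') * edist p q))
      by (apply Rmult_le_pos; [apply Rabs_pos | apply edist_nonneg]).
    f_equal. rewrite Rpow_mult_distr, pow2_abs, !edist_sqr. unfold z. simpl. ring. }
  assert (Hz0 : z 0 = p) by (unfold z; destruct p; simpl; f_equal; ring).
  assert (Hz1 : z 1 = q) by (unfold z; destruct q; simpl; f_equal; ring).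
  pose proof (edist_nonneg p q) as Hpq.
  enough (H : G (z 0) -> G (z 1)) by (rewrite Hz0, Hz1 in H; exact (Hq (H Hp))).
  apply (interval_creeping (fun u v => G (z u) -> G (z v)) 0 1); [lra | tauto |].
  intros m Hm.
  assert (Hnb : ~ boundary G (z m)).
  { intros Hb. apply Hno. exists (z m). split; [exact Hb |].
    rewrite <- Hz0 at 1. rewrite Hz, Rabs_left1 by lra. nra. }
  unfold boundary in Hnb. apply not_all_ex_not in Hnb. destruct Hnb as [eps Hnb].
  apply imply_to_and in Hnb. destruct Hnb as [Heps Hnb].
  exists (eps / (edist p q + 1)). split; [apply Rdiv_lt_0_compat; lra |].
  intros u v Hu Hum Hmv Hv Huv.
  assert (Hd : (v - u) * edist p q < eps).
  { apply Rmult_lt_compat_r with (r := edist p q + 1) in Huv; [| lra].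
    unfold Rdiv in Huv. rewrite Rmult_assoc, Rinv_l, Rmult_1_r in Huv by lra. nra. }
  assert (Hball : edist (z u) (z m) < eps /\ edist (z v) (z m) < eps).
  { rewrite !Hz. rewrite (Rabs_left1 (u - m)), (Rabs_pos_eq (v - m)) by lra. split; nra. }
  intros HGu. apply NNPP. intros HGv. apply Hnb. split.
  - exists (z u). tauto.
  - exists (z v). tauto.
Qed.

Lemma boundary_nonempty (G : pt -> Prop) (p q : pt) :
  G p -> ~ G q -> exists z, boundary G z.
Proof.
  intros Hp Hq. destruct (boundary_on_segment G p q Hp Hq) as [z [Hz _]].
  exists z. exact Hz.
Qed.

Lemma dG_le_edist_outside (G : pt -> Prop) (p q : pt) :
  G p -> ~ G q -> dG G p <= edist p q.
Proof.
  intros Hp Hq. destruct (boundary_on_segment G p q Hp Hq) as [z [Hz Hd]].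
  apply Rle_trans with (edist p z); [| exact Hd].
  apply dG_is_glb; exists z; [exact Hz | split; [exact Hz | reflexivity]].
Qed.

Lemma dG_lipschitz (G : pt -> Prop) (p q : pt) :
  (exists z, boundary G z) -> dG G q - edist p q <= dG G p.
Proof.
  intros Hb. apply (dG_is_glb G p Hb). intros r [z [Hz ->]].
  assert (dG G q <= edist q z).
  { apply (dG_is_glb G q Hb). exists z. split; [exact Hz | reflexivity]. }
  pose proof (edist_triangle q p z). rewrite (edist_sym q p) in *. lra.
Qed.

(** * Quasihyperbolic length *)

(** Close to a parameter [m], the Lipschitz property keeps [dG] above half of its value at [g m];
    such local bounds are glued by taking maxima. *)
Lemma inv_dG_bounded_on_curve (G : pt -> Prop) (g : R -> pt) (s t : R) :
  (exists z, boundary G z) -> (forall p, G p -> 0 < dG G p) ->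
  s <= t -> curve_continuous g s t -> (forall u, s <= u <= t -> G (g u)) ->
  exists M, forall u, s <= u <= t -> / dG G (g u) <= M.
Proof.
  intros Hb Hpos Hst Hc HG.
  apply (interval_creeping
           (fun u v => exists M, forall w, u <= w <= v -> / dG G (g w) <= M) s t Hst).
  - intros u v w _ _ _ _ [M1 H1] [M2 H2]. exists (Rmax M1 M2). intros x Hx.
    destruct (Rle_dec x v).
    + eapply Rle_trans; [apply H1; lra | apply Rmax_l].
    + eapply Rle_trans; [apply H2; lra | apply Rmax_r].
  - intros m Hm. pose proof (Hpos _ (HG m Hm)) as Hd.
    destruct (Hc m Hm (dG G (g m) / 2)) as [d [Hd0 H]]; [lra |].
    exists d. split; [exact Hd0 |]. intros u v H1 H2 H3 H4 H5.
    exists (/ (dG G (g m) / 2)). intros w Hw.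
    apply Rinv_le_contravar; [lra |].
    assert (edist (g w) (g m) < dG G (g m) / 2).
    { apply H; [lra |]. apply Rabs_def1; lra. }
    pose proof (dG_lipschitz G (g w) (g m) Hb). lra.
Qed.

(** The condition on [phi] is the integrated form of |grad phi| <= 1 / D. On a short arc [D] is
    nearly constant, so a lower sum with a single piece already reaches [1 - eps] times the
    increment of [phi]. *)
Lemma line_integral_ge (G : pt -> Prop) (D phi : pt -> R) (g : R -> pt) (s t : R) :
  (exists z, boundary G z) -> (forall p, G p -> 0 < dG G p) ->
  (forall p, G p -> dG G p <= D p) ->
  (forall p q, G p -> G q -> Rabs (D p - D q) <= edist p q) ->
  (forall p q, G p -> G q -> Rmin (D p) (D q) * (phi q - phi p) <= edist p q) ->
  s <= t -> curve_continuous g s t -> rectifiable g s t ->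
  (forall u, s <= u <= t -> G (g u)) ->
  phi (g t) - phi (g s) <= line_integral (fun z => / dG G z) g s t.
Proof.
  intros Hb Hpos HD HLip Hphi Hst Hc Hr HG.
  set (f := fun z => / dG G z).
  assert (Hf : forall z, 0 <= f z) by (intros z; apply inv_dG_nonneg).
  destruct (inv_dG_bounded_on_curve G g s t Hb Hpos Hst Hc HG) as [M HM].
  pose proof (lower_sum_le_line_integral f g s t M Hf Hst Hr HM) as HI.
  assert (Hall : forall eps, 0 < eps -> eps < 1 ->
            (1 - eps) * (phi (g t) - phi (g s)) <= line_integral f g s t).
  { intros eps Heps Heps1.
    enough (exists v, lower_sums f g s t v /\ (1 - eps) * (phi (g t) - phi (g s)) <= v)
      as [v [Hv Hle]] by (specialize (HI v Hv); lra).
    apply (interval_creeping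
      (fun s t => exists v, lower_sums f g s t v /\ (1 - eps) * (phi (g t) - phi (g s)) <= v)
      s t Hst).
    - intros x y z _ _ _ _ [v [Hv Hv']] [w [Hw Hw']]. exists (v + w).
      split; [eapply lower_sums_concat; eauto | lra].
    - intros m Hm. pose proof (HG m Hm) as HGm.
      pose proof (Hpos _ HGm). pose proof (HD _ HGm).
      set (K := D (g m)) in *. assert (HK : 0 < K) by lra.
      destruct (Hc m Hm (eps / 2 * K)) as [d [Hd H1]]; [nra |].
      exists d. split; [exact Hd |]. intros u v Hsu Hum Hmv Hvt Huv.
      exists (lower_term f g u v). split; [apply lower_sums_one; lra |].
      assert (Hnear : forall w, u <= w <= v ->
                (1 - eps / 2) * K <= D (g w) <= (1 + eps / 2) * K).
      { intros w Hw.
        assert (edist (g w) (g m) < eps / 2 * K).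
        { apply H1; [lra |]. apply Rabs_def1; lra. }
        pose proof (HLip (g w) (g m) (HG w ltac:(lra)) HGm) as HL.
        assert (Habs : Rabs (D (g w) - K) <= eps / 2 * K) by (fold K in HL; lra).
        revert Habs. unfold Rabs. destruct (Rcase_abs _); lra. }
      assert (Hinf : / ((1 + eps / 2) * K) <=
                Rinf (fun y => exists w, u <= w <= v /\ y = f (g w))).
      { apply (inf_on_interval f g u v Hf); [lra |].
        intros y [w [Hw ->]]. unfold f.
        assert (HGw : G (g w)) by (apply HG; lra).
        apply Rinv_le_contravar; [apply Hpos; exact HGw |].
        specialize (Hnear w Hw). specialize (HD _ HGw). lra. }
      assert (Hlen : edist (g u) (g v) <= curve_length g u v).
      { rewrite edist_sym. apply curve_length_ge_chord; [lra |].
        apply rectifiable_sub with s t; try lra. exact Hr. }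
      pose proof (Hphi (g u) (g v) (HG u ltac:(lra)) (HG v ltac:(lra))) as Hp.
      assert (HKe : 0 < (1 + eps / 2) * K) by nra.
      apply Rle_trans with (/ ((1 + eps / 2) * K) * edist (g u) (g v)).
      + apply Rmult_le_reg_l with ((1 + eps / 2) * K); [exact HKe |].
        rewrite <- (Rmult_assoc _ (/ _)), Rinv_r, Rmult_1_l by lra.
        pose proof (edist_nonneg (g u) (g v)).
        assert (Hmin : (1 - eps / 2) * K <= Rmin (D (g u)) (D (g v))).
        { apply Rmin_glb; apply Hnear; lra. }
        (* If [phi] does not increase, the left side is at most 0; otherwise
           [(1 - eps) * (1 + eps / 2) <= 1 - eps / 2] is what is needed. *)
        destruct (Rle_dec (phi (g v) - phi (g u)) 0) as [Hneg | Hpos'].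
        * assert (0 <= (1 + eps / 2) * K * (1 - eps)) by (apply Rmult_le_pos; nra). nra.
        * assert ((1 + eps / 2) * K * (1 - eps) <= (1 - eps / 2) * K) by nra. nra.
      + unfold lower_term. apply Rmult_le_compat; try assumption.
        * left. apply Rinv_0_lt_compat. exact HKe.
        * apply edist_nonneg. }
  apply Rnot_lt_le. intros Hlt. fold f in Hlt.
  pose proof (line_integral_nonneg f g s t Hf Hst) as H0.
  set (I := line_integral f g s t) in *. set (J := phi (g t) - phi (g s)) in *.
  (* With this [e], [(1 - e) * J] is the midpoint of [I] and [J], hence larger than [I]. *)
  assert (He : exists e, 0 < e /\ e * J = (J - I) / 2).
  { exists ((J - I) / (2 * J)). split; [apply Rdiv_lt_0_compat; lra | field; lra]. }
  destruct He as [e [He HeJ]].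
  assert (He1 : e < 1) by nra.
  specialize (Hall e He He1). nra.
Qed.

Lemma lipschitz_continuous (g : R -> pt) (s t L : R) : 0 < L ->
  (forall u v, s <= u <= t -> s <= v <= t -> edist (g u) (g v) <= L * Rabs (u - v)) ->
  curve_continuous g s t.
Proof.
  intros HL Hg u Hu eps Heps. exists (eps / L). split; [apply Rdiv_lt_0_compat; lra |].
  intros v Hv Huv. eapply Rle_lt_trans; [apply Hg; assumption |].
  apply Rmult_lt_compat_l with (r := L) in Huv; [| exact HL].
  replace (L * (eps / L)) with eps in Huv by (field; lra). exact Huv.
Qed.

Lemma lipschitz_rectifiable (g : R -> pt) (s t L : R) : 0 < L ->
  (forall u v, s <= u <= t -> s <= v <= t -> edist (g u) (g v) <= L * Rabs (u - v)) ->
  rectifiable g s t.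
Proof.
  intros HL Hg. exists (L * (t - s)). intros l [n [p [Hp ->]]].
  pose proof (partition_bounds s t n p Hp) as Hb.
  apply Rle_trans with (partition_sum (fun u v => L * (v - u)) n p).
  - apply sumn_R_le. intros i Hi.
    assert (p i <= p (S i)) by (apply Hp; exact Hi).
    rewrite <- (Rabs_pos_eq (p (S i) - p i)) by lra.
    apply Hg; apply Hb; lia.
  - apply (superadditive_partition_sum (fun u v => L * (v - u)) s t);
      [lra | intros; lra | exact Hp].
Qed.

(** The set whose infimum is [kG], named so that its nonemptiness can be stated: for an empty set
    [kG] would be the default 0. *)
Definition qh_lengths (G : pt -> Prop) (x y : pt) (v : R) : Prop :=
  exists (g : R -> pt) (s t : R),
    s <= t /\ g s = x /\ g t = y /\
    curve_continuous g s t /\ rectifiable g s t /\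
    (forall u, s <= u <= t -> G (g u)) /\
    v = line_integral (fun z => / dG G z) g s t.

Lemma kG_is_glb (G : pt -> Prop) (x y : pt) :
  (exists v, qh_lengths G x y v) -> is_glb (qh_lengths G x y) (kG G x y).
Proof.
  intros Hne. apply Rinf_is_glb with 0; [exact Hne |].
  intros v (g & s & t & Hst & _ & _ & _ & _ & _ & ->).
  apply line_integral_nonneg; [intros z; apply inv_dG_nonneg | exact Hst].
Qed.

Lemma kG_ge (G : pt -> Prop) (D phi : pt -> R) (x y : pt) :
  (exists v, qh_lengths G x y v) ->
  (exists z, boundary G z) -> (forall p, G p -> 0 < dG G p) ->
  (forall p, G p -> dG G p <= D p) ->
  (forall p q, G p -> G q -> Rabs (D p - D q) <= edist p q) ->
  (forall p q, G p -> G q -> Rmin (D p) (D q) * (phi q - phi p) <= edist p q) ->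
  phi y - phi x <= kG G x y.
Proof.
  intros Hne Hb Hpos HD HL Hphi. apply (kG_is_glb G x y Hne).
  intros v (g & s & t & Hst & <- & <- & Hc & Hr & HG & ->).
  apply (line_integral_ge G D phi); assumption.
Qed.

(** * Elementary inequalities *)

Lemma Rle_div_of_mult (x y z : R) : 0 < z -> x * z <= y -> x <= y / z.
Proof.
  intros Hz H. apply Rmult_le_reg_r with z; [exact Hz |].
  unfold Rdiv. rewrite Rmult_assoc, Rinv_l by lra. lra.
Qed.

Lemma Rdiv_le_of_mult (x y z : R) : 0 < z -> y <= x * z -> y / z <= x.
Proof.
  intros Hz H. apply Rmult_le_reg_r with z; [exact Hz |].
  unfold Rdiv. rewrite Rmult_assoc, Rinv_l by lra. lra.
Qed.

Lemma ln_le_compat (x y : R) : 0 < x -> x <= y -> ln x <= ln y.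
Proof.
  intros Hx [H | ->]; [left; apply ln_increasing; assumption | lra].
Qed.

Lemma ln_le_sub1 (x : R) : 0 < x -> ln x <= x - 1.
Proof.
  intros Hx. pose proof (exp_ineq1_le (ln x)) as H. rewrite exp_ln in H by exact Hx. lra.
Qed.

Lemma ln_div (x y : R) : 0 < x -> 0 < y -> ln (x / y) = ln x - ln y.
Proof.
  intros Hx Hy. unfold Rdiv.
  rewrite ln_mult, ln_Rinv; [ring | lra | lra | apply Rinv_0_lt_compat; lra].
Qed.

Lemma ln_sub_le (x y : R) : 0 < x -> 0 < y -> ln y - ln x <= (y - x) / x.
Proof.
  intros Hx Hy. rewrite <- ln_div by assumption.
  eapply Rle_trans; [apply ln_le_sub1; apply Rdiv_lt_0_compat; assumption |].
  right. field. lra.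
Qed.

(** [M = 1 + z / c] is the mean of [1 + z] with weight [1 / c] and of 1 with the remaining weight.
    The tangent of [ln] at [M] bounds [ln] at both points, and its slope cancels in the mean. *)
Lemma ln_concave_at_1 (c z : R) : 1 <= c -> 0 <= z ->
  ln (1 + z) <= c * ln (1 + z / c).
Proof.
  intros Hc Hz.
  assert (Hzc : 0 <= z / c) by (apply Rle_div_of_mult; lra).
  set (M := 1 + z / c). assert (HM : 1 <= M) by (unfold M; lra).
  assert (HcM : c * M = c + z) by (unfold M; field; lra).
  pose proof (ln_sub_le M (1 + z) ltac:(lra) ltac:(lra)) as H1.
  pose proof (ln_sub_le M 1 ltac:(lra) ltac:(lra)) as H2.
  rewrite ln_1 in H2.
  assert (H3 : (c - 1) * (0 - ln M) <= (c - 1) * ((1 - M) / M))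
    by (apply Rmult_le_compat_l; lra).
  assert (H4 : (1 + z - M) / M + (c - 1) * ((1 - M) / M) = (c + z - c * M) / M)
    by (field; lra).
  rewrite HcM in H4. replace ((c + z - (c + z)) / M) with 0 in H4 by (field; lra).
  lra.
Qed.

Lemma Rmin_mult_distr_l (r x y : R) : 0 <= r -> Rmin (r * x) (r * y) = r * Rmin x y.
Proof.
  intros Hr. destruct (Rle_dec x y) as [H | H].
  - rewrite !Rmin_left; [reflexivity | exact H | apply Rmult_le_compat_l; assumption].
  - rewrite !Rmin_right; [reflexivity | lra | apply Rmult_le_compat_l; lra].
Qed.

(* The odd antiderivative of [1 / (1 - |v|)]. *)
Definition signed_log (v : R) : R := ln (1 + Rmin v 0) - ln (1 - Rmax v 0).

(** Negative and positive parts are separated, and the tangent bound for [ln] is applied to each.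
    For [v' < v] monotonicity makes the left side nonpositive. *)
Lemma signed_log_lipschitz (v v' : R) : Rabs v < 1 -> Rabs v' < 1 ->
  Rmin (1 - Rabs v) (1 - Rabs v') * (signed_log v' - signed_log v) <= Rabs (v' - v).
Proof.
  intros Hv Hv'.
  set (m := Rmin (1 - Rabs v) (1 - Rabs v')).
  assert (Hm0 : 0 < m) by (apply Rmin_glb_lt; lra).
  assert (Hm1 : m <= 1 - Rabs v) by apply Rmin_l.
  assert (Hm2 : m <= 1 - Rabs v') by apply Rmin_r.
  clearbody m.
  assert (Hneg : Rabs v = Rmax v 0 - Rmin v 0 /\ v = Rmin v 0 + Rmax v 0
                 /\ Rmin v 0 <= 0 <= Rmax v 0).
  { unfold Rabs, Rmin, Rmax. destruct (Rcase_abs v), (Rle_dec v 0); lra. }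
  assert (Hneg' : Rabs v' = Rmax v' 0 - Rmin v' 0 /\ v' = Rmin v' 0 + Rmax v' 0
                 /\ Rmin v' 0 <= 0 <= Rmax v' 0).
  { unfold Rabs, Rmin, Rmax. destruct (Rcase_abs v'), (Rle_dec v' 0); lra. }
  unfold signed_log.
  destruct (Rle_dec v v') as [Hle | Hlt].
  - rewrite Rabs_pos_eq by lra.
    assert (Hmin : Rmin v 0 <= Rmin v' 0) by (apply Rle_min_compat_r; exact Hle).
    assert (Hmax : Rmax v 0 <= Rmax v' 0) by (apply Rle_max_compat_r; exact Hle).
    pose proof (ln_sub_le (1 + Rmin v 0) (1 + Rmin v' 0) ltac:(lra) ltac:(lra)) as H1.
    pose proof (ln_sub_le (1 - Rmax v' 0) (1 - Rmax v 0) ltac:(lra) ltac:(lra)) as H2.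
    assert (Hdiv : forall d x, 0 <= x -> m <= d -> m * (x / d) <= x).
    { intros d x Hx Hd. replace (m * (x / d)) with (m * x / d) by (field; lra).
      apply Rdiv_le_of_mult; [lra | nra]. }
    pose proof (Hdiv (1 + Rmin v 0) (1 + Rmin v' 0 - (1 + Rmin v 0)) ltac:(lra) ltac:(lra)).
    pose proof (Hdiv (1 - Rmax v' 0) (1 - Rmax v 0 - (1 - Rmax v' 0)) ltac:(lra) ltac:(lra)).
    nra.
  - assert (Hmin : Rmin v' 0 <= Rmin v 0) by (apply Rle_min_compat_r; lra).
    assert (Hmax : Rmax v' 0 <= Rmax v 0) by (apply Rle_max_compat_r; lra).
    pose proof (ln_le_compat (1 + Rmin v' 0) (1 + Rmin v 0) ltac:(lra) ltac:(lra)).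
    pose proof (ln_le_compat (1 - Rmax v 0) (1 - Rmax v' 0) ltac:(lra) ltac:(lra)).
    pose proof (Rabs_pos (v' - v)). nra.
Qed.

Lemma signed_log_pos (v : R) : 0 <= v -> signed_log v = - ln (1 - v).
Proof.
  intros Hv. unfold signed_log. rewrite Rmin_right, Rmax_left by lra.
  rewrite Rplus_0_r, ln_1. ring.
Qed.

Lemma signed_log_neg (v : R) : v <= 0 -> signed_log v = ln (1 + v).
Proof.
  intros Hv. unfold signed_log. rewrite Rmin_left, Rmax_right by lra.
  rewrite Rminus_0_r, ln_1. ring.
Qed.

(** The mean value theorem is applied to [sin], since the derivative of [asin] is singular at the
    ends. Between -pi/2 and pi/2, [cos] on a subinterval is at least the smaller of its two end
    values. *)
Lemma asin_lipschitz (s s' : R) : -1 <= s <= 1 -> -1 <= s' <= 1 ->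
  Rmin (sqrt (1 - s ^ 2)) (sqrt (1 - s' ^ 2)) * (asin s' - asin s) <= Rabs (s' - s).
Proof.
  intros Hs Hs'.
  pose proof (cos_asin s Hs) as Hc. pose proof (cos_asin s' Hs') as Hc'.
  pose proof (sin_asin s Hs) as Hsn. pose proof (sin_asin s' Hs') as Hsn'.
  rewrite Rsqr_pow2 in Hc, Hc'. rewrite <- Hc, <- Hc'.
  pose proof (asin_bound s) as Hb. pose proof (asin_bound s') as Hb'.
  set (al := asin s) in *. set (be := asin s') in *.
  assert (Hmin : 0 <= Rmin (cos al) (cos be))
    by (apply Rmin_glb; [rewrite Hc | rewrite Hc']; apply sqrt_pos).
  pose proof (Rabs_pos (s' - s)). pose proof PI_RGT_0.
  destruct (Rle_dec be al) as [Hle | Hlt]; [nra |].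
  destruct (MVT_cor2 sin cos al be ltac:(lra)) as [xi [Heq Hxi]];
    [intros; apply derivable_pt_lim_sin |].
  rewrite Hsn, Hsn' in Heq. rewrite Heq.
  apply Rle_trans with (cos xi * (be - al)); [| apply Rle_abs].
  apply Rmult_le_compat_r; [lra |].
  destruct (Rle_dec 0 xi).
  - eapply Rle_trans; [apply Rmin_r |]. apply cos_decr_1; lra.
  - eapply Rle_trans; [apply Rmin_l |]. rewrite <- (cos_neg al), <- (cos_neg xi).
    apply cos_decr_1; lra.
Qed.

Definition clamp (l u : R) : R := Rmax (- l) (Rmin u l).

Lemma clamp_lipschitz (l u v : R) : Rabs (clamp l u - clamp l v) <= Rabs (u - v).
Proof.
  unfold clamp, Rmax, Rmin, Rabs.
  destruct (Rle_dec u l), (Rle_dec v l);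
  repeat (match goal with |- context [Rle_dec ?x ?y] => destruct (Rle_dec x y) end);
    repeat (match goal with |- context [Rcase_abs ?x] => destruct (Rcase_abs x) end); lra.
Qed.

Lemma clamp_bound (l u : R) : 0 <= l -> - l <= clamp l u <= l.
Proof.
  intros Hl. unfold clamp. split; [apply Rmax_l |].
  apply Rmax_lub; [lra | apply Rmin_r].
Qed.

Lemma clamp_id (l u : R) : - l <= u <= l -> clamp l u = u.
Proof. intros Hu. unfold clamp. rewrite Rmin_left, Rmax_right; lra. Qed.

Lemma clamp_outside (l u : R) : 0 <= l -> ~ (- l <= u <= l) -> clamp l u ^ 2 = l ^ 2.
Proof.
  intros Hl Hu. unfold clamp, Rmax, Rmin.
  destruct (Rle_dec u l); destruct (Rle_dec _ _); try ring; exfalso; lra.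
Qed.

(** * Hyperbolic segments in the unit disc *)

Definition normsq (p : pt) : R := fst p ^ 2 + snd p ^ 2.

Lemma normsq_nonneg (p : pt) : 0 <= normsq p.
Proof. apply Rplus_le_le_0_compat; apply pow2_ge_0. Qed.

(* In complex notation [(x + u w) / (1 + u x^* w)]: the image of the diameter
   through [w] under the disc automorphism that maps [0] to [x]. *)
Definition moebius_den (x w : pt) (u : R) : R :=
  (1 + u * (fst x * fst w + snd x * snd w)) ^ 2
  + (u * (fst x * snd w - snd x * fst w)) ^ 2.

Definition moebius_line (x w : pt) (u : R) : pt :=
  let m1 := fst x * fst w + snd x * snd w in
  let m2 := fst x * snd w - snd x * fst w in
  (((fst x + u * fst w) * (1 + u * m1) + (snd x + u * snd w) * (u * m2))
     / moebius_den x w u,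
   ((snd x + u * snd w) * (1 + u * m1) - (fst x + u * fst w) * (u * m2))
     / moebius_den x w u).

(** [m1] and [m2] are the real and imaginary parts of x^* w, which has modulus below 1; hence
    [1 + u * m1] is positive. *)
Lemma moebius_den_pos (x w : pt) (u : R) :
  normsq x < 1 -> normsq w < 1 -> 0 <= u <= 1 -> 0 < moebius_den x w u.
Proof.
  destruct x as [x1 x2], w as [w1 w2]. unfold normsq, moebius_den. simpl fst; simpl snd.
  intros Hx Hw Hu.
  set (m1 := x1 * w1 + x2 * w2). set (m2 := x1 * w2 - x2 * w1).
  assert (Hm : m1 ^ 2 + m2 ^ 2 = (x1 ^ 2 + x2 ^ 2) * (w1 ^ 2 + w2 ^ 2))
    by (unfold m1, m2; ring).
  assert (m1 ^ 2 + m2 ^ 2 < 1).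
  { rewrite Hm. pose proof (pow2_ge_0 x1). pose proof (pow2_ge_0 x2).
    pose proof (pow2_ge_0 w1). pose proof (pow2_ge_0 w2). nra. }
  clearbody m1 m2. clear Hm Hx Hw. pose proof (pow2_ge_0 m2).
  assert (-1 < m1) by nra.
  assert (0 < 1 + u * m1) by (destruct (Rle_dec 0 m1); nra).
  pose proof (pow2_ge_0 (u * m2)). nra.
Qed.

Lemma moebius_line_normsq (x w : pt) (u : R) : moebius_den x w u <> 0 ->
  1 - normsq (moebius_line x w u)
  = (1 - normsq x) * (1 - u ^ 2 * normsq w) / moebius_den x w u.
Proof.
  intros Hd. unfold normsq, moebius_line. simpl fst; simpl snd.
  unfold moebius_den in *. field. exact Hd.
Qed.

Lemma moebius_line_edist (x w : pt) (u v : R) :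
  moebius_den x w u <> 0 -> moebius_den x w v <> 0 ->
  edist (moebius_line x w u) (moebius_line x w v) ^ 2
  = (u - v) ^ 2 * normsq w * (1 - normsq x) ^ 2
    / (moebius_den x w u * moebius_den x w v).
Proof.
  intros Hu Hv. rewrite edist_sqr. unfold normsq, moebius_line. simpl fst; simpl snd.
  unfold moebius_den in *. field. split; assumption.
Qed.

(** [sg] is the pseudohyperbolic distance of [x] and [y]. The last clause is the invariance of |z -
    z'|^2 / ((1 - |z|^2) (1 - |z'|^2)), evaluated at the points at signed distance [sg * u] and
    [sg * v] from 0 on a diameter. *)
Lemma hyperbolic_segment (x y : pt) : normsq x < 1 -> normsq y < 1 ->
  exists (gam : R -> pt) (sg : R),
    0 <= sg < 1 /\
    sg ^ 2 * (edist x y ^ 2 + (1 - normsq x) * (1 - normsq y)) = edist x y ^ 2 /\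
    gam 0 = x /\ gam 1 = y /\
    (forall u, 0 <= u <= 1 -> normsq (gam u) < 1) /\
    (forall u v, 0 <= u <= 1 -> 0 <= v <= 1 ->
       edist (gam u) (gam v) ^ 2 * ((1 - (sg * u) ^ 2) * (1 - (sg * v) ^ 2))
       = (sg * (u - v)) ^ 2 * ((1 - normsq (gam u)) * (1 - normsq (gam v)))).
Proof.
  intros Hx Hy.
  (* [A1 + i A2] is 1 - x^* y, and [w] below is (y - x) / (1 - x^* y), the image of [y] under the
     automorphism taking [x] to 0. *)
  set (A1 := 1 - fst x * fst y - snd x * snd y).
  set (A2 := - (fst x * snd y - snd x * fst y)).
  set (T2 := edist x y ^ 2).
  set (P := (1 - normsq x) * (1 - normsq y)).
  assert (HT2 : 0 <= T2) by apply pow2_ge_0.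
  assert (HP : 0 < P) by (unfold P; apply Rmult_lt_0_compat; lra).
  assert (HDA : A1 ^ 2 + A2 ^ 2 = T2 + P).
  { unfold A1, A2, T2, P. rewrite edist_sqr. unfold normsq. ring. }
  set (w := (((fst y - fst x) * A1 + (snd y - snd x) * A2) / (A1 ^ 2 + A2 ^ 2),
             ((snd y - snd x) * A1 - (fst y - fst x) * A2) / (A1 ^ 2 + A2 ^ 2))).
  assert (HA : A1 ^ 2 + A2 ^ 2 <> 0) by lra.
  assert (Hw : normsq w = T2 / (T2 + P)).
  { rewrite <- HDA. unfold T2, normsq, w. rewrite edist_sqr. simpl fst; simpl snd.
    field. exact HA. }
  assert (Hw1 : normsq w < 1).
  { rewrite Hw. apply Rmult_lt_reg_r with (T2 + P); [lra |].
    unfold Rdiv. rewrite Rmult_assoc, Rinv_l by lra. lra. }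
  pose proof (normsq_nonneg w) as Hw0.
  assert (Hsg : sqrt (normsq w) ^ 2 = normsq w) by (apply pow2_sqrt; exact Hw0).
  assert (Hden : forall u, 0 <= u <= 1 -> 0 < moebius_den x w u)
    by (intros u Hu; apply moebius_den_pos; assumption).
  exists (moebius_line x w), (sqrt (normsq w)).
  split; [| split; [| split; [| split; [| split]]]].
  - split; [apply sqrt_pos |]. rewrite <- sqrt_1. apply sqrt_lt_1; lra.
  - rewrite Hsg, Hw. field. lra.
  - unfold moebius_line, moebius_den. destruct x as [x1 x2]. simpl. f_equal; field; lra.
  - pose proof (Hden 1 ltac:(lra)) as Hd. unfold moebius_line.
    assert (Hden1 : moebius_den x w 1 * (A1 ^ 2 + A2 ^ 2) = (1 - normsq x) ^ 2).
    { unfold moebius_den, w. simpl fst; simpl snd. unfold normsq.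
      unfold A1, A2 in *. field. lra. }
    destruct y as [y1 y2]. simpl fst in *; simpl snd in *.
    assert (Hdx : moebius_den x w 1 = (1 - normsq x) ^ 2 / (A1 ^ 2 + A2 ^ 2)).
    { rewrite <- Hden1. field. exact HA. }
    rewrite Hdx. unfold w, normsq in *. simpl fst; simpl snd. unfold A1, A2 in *.
    f_equal; field; split; nra.
  - intros u Hu. specialize (Hden u Hu).
    assert (0 < 1 - normsq (moebius_line x w u)); [| lra].
    rewrite moebius_line_normsq by lra.
    apply Rdiv_lt_0_compat; [| exact Hden].
    apply Rmult_lt_0_compat; [lra |]. assert (u ^ 2 <= 1) by nra. nra.
  - intros u v Hu Hv. pose proof (Hden u Hu). pose proof (Hden v Hv).
    rewrite moebius_line_edist, !moebius_line_normsq by lra.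
    rewrite !Rpow_mult_distr, Hsg. field. split; lra.
Qed.

Definition norm (z : pt) : R := edist z (0, 0).

Lemma norm_sqr (z : pt) : norm z ^ 2 = normsq z.
Proof. unfold norm, normsq. rewrite edist_sqr. simpl. ring. Qed.

Lemma norm_nonneg (z : pt) : 0 <= norm z.
Proof. apply edist_nonneg. Qed.

Lemma norm_lt_1 (z : pt) : normsq z < 1 -> norm z < 1.
Proof. intros H. pose proof (norm_sqr z). pose proof (norm_nonneg z). nra. Qed.

Lemma norm_ge_1 (z : pt) : 1 <= normsq z -> 1 <= norm z.
Proof. intros H. pose proof (norm_sqr z). pose proof (norm_nonneg z). nra. Qed.

(* [sg] is the hyperbolic tangent of half the hyperbolic distance of two points
   of the disc of radius [r] at Euclidean distance [T], with
   [P = (1 - |x|^2) (1 - |y|^2)]. *)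
Lemma hyperbolic_le_twice_j (sg T P r : R) :
  0 <= sg < 1 -> 0 <= r < 1 -> 0 <= T <= 2 * r -> (1 - r ^ 2) ^ 2 <= P ->
  sg ^ 2 * (T ^ 2 + P) = T ^ 2 ->
  ln ((1 + sg) / (1 - sg)) <= 2 * ln (1 + T / (1 - r)).
Proof.
  intros Hsg Hr HT HP Heq.
  set (tau := T / (1 - r)).
  assert (HTt : T = tau * (1 - r)) by (unfold tau; field; lra).
  assert (Htau : 0 <= tau) by (apply Rle_div_of_mult; lra).
  clearbody tau.
  replace (2 * ln (1 + tau)) with (ln ((1 + tau) ^ 2))
    by (rewrite ln_pow by lra; simpl; ring).
  apply ln_le_compat; [apply Rdiv_lt_0_compat; lra |].
  apply Rdiv_le_of_mult; [lra |].
  (* This is the inequality (1 + sg) / (1 - sg) <= (1 + tau)^2 solved for [sg]. *)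
  enough (sg * (tau ^ 2 + 2 * tau + 2) <= tau * (tau + 2)) by nra.
  apply le_of_sqr_le; [nra |]. rewrite !Rpow_mult_distr.
  assert (H1 : sg ^ 2 * (tau ^ 2 + (1 + r) ^ 2) <= tau ^ 2).
  { apply Rmult_le_reg_l with ((1 - r) ^ 2); [apply pow_lt; lra |].
    replace ((1 - r) ^ 2 * tau ^ 2) with (T ^ 2) by (rewrite HTt; ring).
    rewrite <- Heq, HTt.
    replace ((1 - r) ^ 2 * (sg ^ 2 * (tau ^ 2 + (1 + r) ^ 2)))
      with (sg ^ 2 * ((tau * (1 - r)) ^ 2 + (1 - r ^ 2) ^ 2)) by ring.
    apply Rmult_le_compat_l; [apply pow2_ge_0 | lra]. }
  (* Equivalent to [tau * (1 - r) <= 2 * r], that is, to [T <= 2 * r]. *)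
  assert (H2 : 2 * tau + 2 <= (1 + r) * (tau + 2)) by nra.
  assert (H3 : (2 * tau + 2) ^ 2 <= ((1 + r) * (tau + 2)) ^ 2) by nra.
  apply Rle_trans with (sg ^ 2 * ((tau + 2) ^ 2 * (tau ^ 2 + (1 + r) ^ 2))).
  - apply Rmult_le_compat_l; [apply pow2_ge_0 |].
    replace ((tau ^ 2 + 2 * tau + 2) ^ 2)
      with (tau ^ 2 * (tau + 2) ^ 2 + (2 * tau + 2) ^ 2) by ring. nra.
  - replace (sg ^ 2 * ((tau + 2) ^ 2 * (tau ^ 2 + (1 + r) ^ 2)))
      with ((tau + 2) ^ 2 * (sg ^ 2 * (tau ^ 2 + (1 + r) ^ 2))) by ring.
    rewrite (Rmult_comm (tau ^ 2)).
    apply Rmult_le_compat_l; [apply pow2_ge_0 | exact H1].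
Qed.

(** With X = (1 + V)(1 - U) and Y = (1 - V)(1 + U), the first estimate says q <= 2 (V - U) / sqrt(X
    Y), while the tangent bound for [ln] makes the increment at least 2 (V - U) / X. As X - Y = 2 (V
    - U), the smallness condition reads X <= (1 + eps) Y. *)
Lemma hyperbolic_chord_le (U V q eps : R) :
  0 <= U -> U <= V -> V < 1 -> 0 <= q -> 0 < eps ->
  q ^ 2 * ((1 - U ^ 2) * (1 - V ^ 2)) <= 4 * (V - U) ^ 2 ->
  2 * (V - U) <= eps * ((1 - V) * (1 + U)) ->
  q <= (1 + eps) * (ln ((1 + V) / (1 - V)) - ln ((1 + U) / (1 - U))).
Proof.
  intros HU HUV HV Hq Heps H1 H2.
  rewrite !ln_div by lra.
  assert (Hln : 2 * (V - U) / ((1 + V) * (1 - U))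
                <= ln (1 + V) - ln (1 - V) - (ln (1 + U) - ln (1 - U))).
  { pose proof (ln_sub_le ((1 + V) * (1 - U)) ((1 - V) * (1 + U))) as H.
    rewrite !ln_mult in H by lra.
    assert (Heq : ((1 - V) * (1 + U) - (1 + V) * (1 - U)) / ((1 + V) * (1 - U))
                  = - (2 * (V - U) / ((1 + V) * (1 - U)))) by (field; lra).
    rewrite Heq in H. specialize (H ltac:(nra) ltac:(nra)). lra. }
  apply Rle_trans with ((1 + eps) * (2 * (V - U) / ((1 + V) * (1 - U))));
    [| apply Rmult_le_compat_l; lra].
  replace ((1 + eps) * (2 * (V - U) / ((1 + V) * (1 - U))))
    with ((1 + eps) * (2 * (V - U)) / ((1 + V) * (1 - U))) by (field; lra).
  set (X := (1 + V) * (1 - U)) in *. set (Y := (1 - V) * (1 + U)) in *.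
  assert (HX : 0 < X) by (unfold X; nra). assert (HY : 0 < Y) by (unfold Y; nra).
  assert (HXY : X <= (1 + eps) * Y) by (unfold X, Y in *; lra).
  assert (Hq2 : q ^ 2 * (X * Y) <= 4 * (V - U) ^ 2).
  { replace (X * Y) with ((1 - U ^ 2) * (1 - V ^ 2)) by (unfold X, Y; ring). exact H1. }
  apply Rle_div_of_mult; [exact HX |].
  apply le_of_sqr_le; [nra |].
  apply Rle_trans with (q ^ 2 * (X * Y) * (1 + eps)).
  - replace ((q * X) ^ 2) with (q ^ 2 * X * X) by ring.
    replace (q ^ 2 * (X * Y) * (1 + eps)) with (q ^ 2 * X * ((1 + eps) * Y)) by ring.
    apply Rmult_le_compat_l; [| exact HXY].
    apply Rmult_le_pos; [apply pow2_ge_0 | lra].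
  - pose proof (pow2_ge_0 (V - U)).
    replace (((1 + eps) * (2 * (V - U))) ^ 2)
      with (4 * (V - U) ^ 2 * (1 + eps) * (1 + eps)) by ring.
    assert (0 <= 4 * (V - U) ^ 2 * (1 + eps)) by (apply Rmult_le_pos; lra).
    apply Rle_trans with (4 * (V - U) ^ 2 * (1 + eps)); [apply Rmult_le_compat_r; lra | nra].
Qed.

(** * Elliptic domains *)

Section Ellipse.

Context (a b x0 y0 th : R) (hb : 0 < b) (hab : b <= a).

Let E : pt -> Prop := ellipse_domain a b x0 y0 th.

Definition disc_coord (p : pt) : pt :=
  ((cos th * (fst p - x0) + sin th * (snd p - y0)) / a,
   (- sin th * (fst p - x0) + cos th * (snd p - y0)) / b).

Definition disc_point (z : pt) : pt :=
  (x0 + cos th * (a * fst z) - sin th * (b * snd z),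
   y0 + sin th * (a * fst z) + cos th * (b * snd z)).

Local Notation hat := disc_coord.
Local Notation unhat := disc_point.

Lemma ellipse_domain_iff (p : pt) : E p <-> normsq (hat p) < 1.
Proof. reflexivity. Qed.

Lemma disc_coordK (z : pt) : hat (unhat z) = z.
Proof.
  destruct z as [u v]. unfold disc_coord, disc_point. simpl fst; simpl snd.
  pose proof (sin2_cos2 th) as Hsc. unfold Rsqr in Hsc.
  f_equal.
  - replace (_ + _) with ((sin th * sin th + cos th * cos th) * (a * u)) by ring.
    rewrite Hsc. field. lra.
  - replace (_ + _) with ((sin th * sin th + cos th * cos th) * (b * v)) by ring.
    rewrite Hsc. field. lra.
Qed.

Lemma disc_pointK (p : pt) : unhat (hat p) = p.
Proof.
  destruct p as [u v]. unfold disc_coord, disc_point. simpl fst; simpl snd.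
  pose proof (sin2_cos2 th) as Hsc. unfold Rsqr in Hsc.
  f_equal.
  - transitivity (x0 + (sin th * sin th + cos th * cos th) * (u - x0));
      [field; lra | rewrite Hsc; ring].
  - transitivity (y0 + (sin th * sin th + cos th * cos th) * (v - y0));
      [field; lra | rewrite Hsc; ring].
Qed.

Lemma edist_disc_coord (p q : pt) :
  edist p q ^ 2
  = a ^ 2 * (fst (hat p) - fst (hat q)) ^ 2 + b ^ 2 * (snd (hat p) - snd (hat q)) ^ 2.
Proof.
  rewrite edist_sqr. unfold disc_coord. simpl fst; simpl snd.
  pose proof (sin2_cos2 th) as Hsc. unfold Rsqr in Hsc.
  set (X := fst p - fst q). set (Y := snd p - snd q).
  transitivity ((cos th * X + sin th * Y) ^ 2 + (- sin th * X + cos th * Y) ^ 2).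
  - transitivity ((sin th * sin th + cos th * cos th) * (X ^ 2 + Y ^ 2));
      [rewrite Hsc; ring | ring].
  - unfold X, Y. field. lra.
Qed.

Lemma edist_disc_coord_ge (p q : pt) : b * edist (hat p) (hat q) <= edist p q.
Proof.
  apply le_of_sqr_le; [apply edist_nonneg |].
  rewrite Rpow_mult_distr, (edist_disc_coord p q), (edist_sqr (hat p)).
  assert (b ^ 2 <= a ^ 2) by nra.
  assert (0 <= (a ^ 2 - b ^ 2) * (fst (hat p) - fst (hat q)) ^ 2)
    by (apply Rmult_le_pos; [lra | apply pow2_ge_0]). lra.
Qed.

Lemma edist_disc_coord_le (p q : pt) : edist p q <= a * edist (hat p) (hat q).
Proof.
  apply le_of_sqr_le; [apply Rmult_le_pos; [lra | apply edist_nonneg] |].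
  rewrite Rpow_mult_distr, (edist_disc_coord p q), (edist_sqr (hat p)).
  assert (b ^ 2 <= a ^ 2) by nra.
  assert (0 <= (a ^ 2 - b ^ 2) * (snd (hat p) - snd (hat q)) ^ 2)
    by (apply Rmult_le_pos; [lra | apply pow2_ge_0]). lra.
Qed.

Lemma edist_disc_coord_fst (p q : pt) :
  a * Rabs (fst (hat p) - fst (hat q)) <= edist p q.
Proof.
  apply le_of_sqr_le; [apply edist_nonneg |].
  rewrite Rpow_mult_distr, pow2_abs, edist_disc_coord.
  assert (0 <= b ^ 2 * (snd (hat p) - snd (hat q)) ^ 2)
    by (apply Rmult_le_pos; apply pow2_ge_0). lra.
Qed.

Lemma edist_disc_coord_snd (p q : pt) :
  b * Rabs (snd (hat p) - snd (hat q)) <= edist p q.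
Proof.
  apply le_of_sqr_le; [apply edist_nonneg |].
  rewrite Rpow_mult_distr, pow2_abs, edist_disc_coord.
  assert (0 <= a ^ 2 * (fst (hat p) - fst (hat q)) ^ 2)
    by (apply Rmult_le_pos; apply pow2_ge_0). lra.
Qed.

Lemma disc_point_inside (z : pt) : normsq z < 1 -> E (unhat z).
Proof. intros H. apply ellipse_domain_iff. rewrite disc_coordK. exact H. Qed.

Lemma disc_point_outside (z : pt) : 1 <= normsq z -> ~ E (unhat z).
Proof. intros H. rewrite ellipse_domain_iff, disc_coordK. lra. Qed.

(** * Comparison of the boundary distance with that of the disc *)

Lemma ellipse_boundary_nonempty : exists z, boundary E z.
Proof.
  apply (boundary_nonempty E (unhat (0, 0)) (unhat (1, 0))).
  - apply disc_point_inside. unfold normsq. simpl. lra.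
  - apply disc_point_outside. unfold normsq. simpl. lra.
Qed.

(** Otherwise the ball of radius [b * (1 - norm (hat z))] about [z] would lie in [E], since [hat]
    stretches distances by at most [1 / b]. *)
Lemma ellipse_boundary_normsq (z : pt) : boundary E z -> 1 <= normsq (hat z).
Proof.
  intros Hb. apply Rnot_lt_le. intros Hlt. apply norm_lt_1 in Hlt.
  destruct (Hb (b * (1 - norm (hat z)))) as [_ [w [HGw Hw]]]; [nra |].
  apply HGw. apply ellipse_domain_iff.
  pose proof (edist_disc_coord_ge w z).
  pose proof (edist_triangle (hat w) (hat z) (0, 0)) as Ht. fold (norm (hat w)) in Ht.
  fold (norm (hat z)) in Ht.
  assert (norm (hat w) < 1) by nra.
  rewrite <- norm_sqr. pose proof (norm_nonneg (hat w)). nra.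
Qed.

Lemma ellipse_dG_ge (p : pt) (l : R) :
  (forall z, 1 <= normsq (hat z) -> l <= edist p z) -> l <= dG E p.
Proof.
  intros H. apply (dG_is_glb E p ellipse_boundary_nonempty).
  intros r [z [Hz ->]]. apply H. apply ellipse_boundary_normsq. exact Hz.
Qed.

Lemma ellipse_dG_ge_disc (p : pt) : b * (1 - norm (hat p)) <= dG E p.
Proof.
  apply ellipse_dG_ge. intros z Hz. apply norm_ge_1 in Hz.
  pose proof (edist_disc_coord_ge p z).
  pose proof (edist_triangle (hat z) (hat p) (0, 0)) as Ht.
  fold (norm (hat z)) in Ht. fold (norm (hat p)) in Ht.
  rewrite (edist_sym (hat z)) in Ht. nra.
Qed.

Lemma ellipse_dG_pos (p : pt) : E p -> 0 < dG E p.
Proof.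
  intros Hp. assert (norm (hat p) < 1) by (apply norm_lt_1; exact Hp).
  pose proof (ellipse_dG_ge_disc p). nra.
Qed.

Lemma ellipse_dG_le_outside (p z : pt) :
  E p -> 1 <= normsq z -> dG E p <= edist p (unhat z).
Proof.
  intros Hp Hz. apply dG_le_edist_outside; [exact Hp |].
  apply disc_point_outside. exact Hz.
Qed.

Lemma ellipse_dG_le_disc (p : pt) : E p -> dG E p <= a * (1 - norm (hat p)).
Proof.
  intros Hp. pose proof (norm_nonneg (hat p)) as HN0.
  assert (HN1 : norm (hat p) < 1) by (apply norm_lt_1; exact Hp).
  (* The witness is the radial projection to the unit circle; the centre, which has none, takes
     [(1, 0)]. *)
  assert (Hz : exists z, 1 <= normsq z /\ edist (hat p) z <= 1 - norm (hat p)).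
  { destruct (Req_dec (norm (hat p)) 0) as [H0 | Hne].
    - exists (1, 0). split; [unfold normsq; simpl; lra |].
      pose proof (edist_triangle (hat p) (0, 0) (1, 0)) as Ht.
      fold (norm (hat p)) in Ht.
      assert (edist (0, 0) (1, 0) <= 1); [| lra].
      apply le_of_sqr_le; [lra |]. rewrite edist_sqr. simpl. lra.
    - pose proof (norm_sqr (hat p)) as Hsq. set (N := norm (hat p)) in *.
      exists (fst (hat p) / N, snd (hat p) / N). split.
      + right. unfold normsq in *. cbn [fst snd].
        replace ((fst (hat p) / N) ^ 2 + (snd (hat p) / N) ^ 2)
          with ((fst (hat p) ^ 2 + snd (hat p) ^ 2) / N ^ 2) by (field; exact Hne).
        rewrite <- Hsq. field. exact Hne.
      + apply le_of_sqr_le; [lra |]. rewrite edist_sqr. unfold normsq in Hsq.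
        cbn [fst snd].
        replace ((fst (hat p) - fst (hat p) / N) ^ 2 + (snd (hat p) - snd (hat p) / N) ^ 2)
          with ((fst (hat p) ^ 2 + snd (hat p) ^ 2) * (1 - 1 / N) ^ 2) by (field; exact Hne).
        rewrite <- Hsq. right. field. exact Hne. }
  destruct Hz as [z [Hz1 Hz2]].
  eapply Rle_trans; [apply (ellipse_dG_le_outside p z Hp Hz1) |].
  eapply Rle_trans; [apply edist_disc_coord_le |]. rewrite disc_coordK. nra.
Qed.

(** * Upper bound: the pulled-back geodesic *)

(** Serves twice: it shows that [qh_lengths] is nonempty, and it bounds [kG]. The factor [a / b]
    arises because lengths grow by at most [a] under [unhat], while [dG] is at least [b] times the
    distance to the unit circle. *)
Lemma ellipse_qh_length (x y : pt) : E x -> E y ->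
  exists v, qh_lengths E x y v /\
    v <= a / b * (2 * ln (1 + edist (hat x) (hat y)
                              / (1 - Rmax (norm (hat x)) (norm (hat y))))).
Proof.
  intros Hx Hy.
  destruct (hyperbolic_segment (hat x) (hat y) Hx Hy)
    as (gam & sg & Hsg & Hsgeq & Hg0 & Hg1 & Hin & Hdist).
  set (F := fun u => a / b * ln ((1 + sg * u) / (1 - sg * u))).
  set (g := fun u => unhat (gam u)).
  assert (Hhat : forall u, hat (g u) = gam u) by (intros u; apply disc_coordK).
  assert (Hsu : forall u, 0 <= u <= 1 -> 0 <= sg * u <= sg) by (intros u Hu; nra).
  assert (Hs2 : 0 < 1 - sg ^ 2) by nra.
  assert (HE : forall u, 0 <= u <= 1 -> E (g u)).
  { intros u Hu. apply disc_point_inside. apply Hin. exact Hu. }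
  (* From the chord identity: the factors on its left are at least [1 - sg ^ 2], those on its right
     at most 1. *)
  assert (HLip : forall u v, 0 <= u <= 1 -> 0 <= v <= 1 ->
            edist (g u) (g v) <= a / (1 - sg ^ 2) * Rabs (u - v)).
  { intros u v Hu Hv. eapply Rle_trans; [apply edist_disc_coord_le |]. rewrite !Hhat.
    replace (a / (1 - sg ^ 2) * Rabs (u - v)) with (a * (Rabs (u - v) / (1 - sg ^ 2)))
      by (field; lra).
    apply Rmult_le_compat_l; [lra |]. apply Rle_div_of_mult; [exact Hs2 |].
    apply le_of_sqr_le; [apply Rabs_pos |].
    rewrite Rpow_mult_distr, pow2_abs.
    pose proof (Hsu u Hu). pose proof (Hsu v Hv).
    pose proof (Hin u Hu). pose proof (Hin v Hv).
    pose proof (normsq_nonneg (gam u)). pose proof (normsq_nonneg (gam v)).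
    apply Rle_trans with (edist (gam u) (gam v) ^ 2
                          * ((1 - (sg * u) ^ 2) * (1 - (sg * v) ^ 2))).
    - apply Rmult_le_compat_l; [apply pow2_ge_0 |].
      replace ((1 - sg ^ 2) ^ 2) with ((1 - sg ^ 2) * (1 - sg ^ 2)) by ring.
      apply Rmult_le_compat; nra.
    - rewrite (Hdist u v Hu Hv).
      rewrite <- (Rmult_1_r ((u - v) ^ 2)).
      apply Rmult_le_compat; [apply pow2_ge_0 | apply Rmult_le_pos; lra | | nra].
      rewrite Rpow_mult_distr. pose proof (pow2_ge_0 (u - v)).
      assert (sg ^ 2 <= 1) by lra. nra. }
  assert (HLpos : 0 < a / (1 - sg ^ 2)) by (apply Rdiv_lt_0_compat; lra).
  assert (Hrect : rectifiable g 0 1) by exact (lipschitz_rectifiable g 0 1 _ HLpos HLip).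
  exists (line_integral (fun z => / dG E z) g 0 1). split.
  { exists g, 0, 1. repeat split; try lra.
    - unfold g. rewrite Hg0. apply disc_pointK.
    - unfold g. rewrite Hg1. apply disc_pointK.
    - exact (lipschitz_continuous g 0 1 _ HLpos HLip).
    - exact Hrect.
    - exact HE. }
  apply Rle_trans with (F 1 - F 0).
  - apply line_integral_le; [intros z; apply inv_dG_nonneg | lra | exact Hrect |].
    (* [1 - sg] bounds [(1 - sg * v) * (1 + sg * u)] from below, so this length meets the smallness
       condition of [hyperbolic_chord_le]. *)
    intros eps Heps. exists (eps * (1 - sg) / 2). split; [nra |].
    intros u v m Hu Huv Hv Hd Hm0 Hmu Hmv.
    assert (Hu' : 0 <= u <= 1) by lra. assert (Hv' : 0 <= v <= 1) by lra.
    (* The bounds at the two ends are multiplied, to match the product in the chord identity. *)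
    assert (Hmb : forall w, 0 <= w <= 1 -> m <= / dG E (g w) ->
              m * b * (1 - normsq (gam w)) <= 2).
    { intros w Hw Hmw.
      pose proof (ellipse_dG_ge_disc (g w)) as Hdg. rewrite Hhat in Hdg.
      pose proof (ellipse_dG_pos (g w) (HE w Hw)) as Hdpos.
      pose proof (norm_sqr (gam w)) as Hn. pose proof (norm_nonneg (gam w)).
      pose proof (norm_lt_1 _ (Hin w Hw)).
      apply Rmult_le_compat_r with (r := dG E (g w)) in Hmw; [| lra].
      rewrite Rinv_l in Hmw by lra.
      assert (m * (b * (1 - norm (gam w))) <= 1) by nra.
      assert (0 <= m * (b * (1 - norm (gam w)))) by (apply Rmult_le_pos; nra).
      rewrite <- Hn.
      replace (m * b * (1 - norm (gam w) ^ 2))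
        with (m * (b * (1 - norm (gam w))) * (1 + norm (gam w))) by ring. nra. }
    pose proof (Hmb u Hu' Hmu) as Hbu. pose proof (Hmb v Hv' Hmv) as Hbv.
    pose proof (Hsu u Hu'). pose proof (Hsu v Hv').
    pose proof (Hin u Hu') as Hinu. pose proof (Hin v Hv') as Hinv.
    set (e := edist (gam v) (gam u)).
    assert (He : 0 <= e) by apply edist_nonneg.
    assert (Hq : m * b * e <= (1 + eps)
              * (ln ((1 + sg * v) / (1 - sg * v)) - ln ((1 + sg * u) / (1 - sg * u)))).
    { apply hyperbolic_chord_le; try lra; [nra | apply Rmult_le_pos; [nra | exact He] | |].
      - rewrite Rpow_mult_distr, Rmult_assoc, (Rmult_comm (1 - (sg * u) ^ 2)).
        unfold e. rewrite (Hdist v u Hv' Hu').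
        replace ((m * b) ^ 2 * ((sg * (v - u)) ^ 2 * ((1 - normsq (gam v)) * (1 - normsq (gam u)))))
          with ((sg * (v - u)) ^ 2
                * ((m * b * (1 - normsq (gam v))) * (m * b * (1 - normsq (gam u))))) by ring.
        replace (4 * (sg * v - sg * u) ^ 2) with ((sg * (v - u)) ^ 2 * (2 * 2)) by ring.
        apply Rmult_le_compat_l; [apply pow2_ge_0 |].
        assert (0 <= m * b) by nra.
        apply Rmult_le_compat; try assumption; apply Rmult_le_pos; lra.
      - assert (sg * v - sg * u <= v - u) by nra.
        assert (1 - sg <= (1 - sg * v) * (1 + sg * u)) by nra.
        assert (eps * (1 - sg) <= eps * ((1 - sg * v) * (1 + sg * u))) by nra. lra. }
    apply Rle_trans with (a / b * (m * b * e)).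
    + replace (a / b * (m * b * e)) with (m * (a * e)) by (field; lra).
      apply Rmult_le_compat_l; [exact Hm0 |].
      eapply Rle_trans; [apply edist_disc_coord_le |]. rewrite !Hhat. unfold e. lra.
    + assert (Hc : 0 <= a / b) by (apply Rle_div_of_mult; lra).
      apply Rmult_le_compat_l with (r := a / b) in Hq; [unfold F; lra | exact Hc].
  - unfold F. rewrite Rmult_0_r, Rmult_1_r.
    replace ((1 + 0) / (1 - 0)) with 1 by field. rewrite ln_1, Rmult_0_r, Rminus_0_r.
    apply Rmult_le_compat_l; [apply Rle_div_of_mult; lra |].
    set (r := Rmax (norm (hat x)) (norm (hat y))).
    pose proof (Rmax_l (norm (hat x)) (norm (hat y))) as Hrx. fold r in Hrx.
    pose proof (Rmax_r (norm (hat x)) (norm (hat y))) as Hry. fold r in Hry.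
    pose proof (norm_nonneg (hat x)). pose proof (norm_nonneg (hat y)).
    assert (Hr1 : r < 1) by (apply Rmax_lub_lt; apply norm_lt_1; assumption).
    apply hyperbolic_le_twice_j with ((1 - normsq (hat x)) * (1 - normsq (hat y)));
      [exact Hsg | lra | split; [apply edist_nonneg |] | | exact Hsgeq].
    + pose proof (edist_triangle (hat x) (0, 0) (hat y)) as Ht.
      rewrite (edist_sym (0, 0)) in Ht. fold (norm (hat x)) in Ht.
      fold (norm (hat y)) in Ht. lra.
    + rewrite <- !norm_sqr.
      replace ((1 - r ^ 2) ^ 2) with ((1 - r ^ 2) * (1 - r ^ 2)) by ring.
      apply Rmult_le_compat; nra.
Qed.

(** Transporting [j] compares [edist x y >= b * T] with a smaller boundary distance of at most
    [a * (1 - r)]; the quotient [b / a] inside the logarithm is what [ln_concave_at_1] takes out. *)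
Lemma ellipse_kG_le (x y : pt) : E x -> E y ->
  kG E x y <= 2 * (a / b) ^ 2 * jG E x y.
Proof.
  intros Hx Hy. destruct (ellipse_qh_length x y Hx Hy) as [v [Hv Hle]].
  destruct (kG_is_glb E x y (ex_intro _ v Hv)) as [Hk _]. specialize (Hk v Hv).
  eapply Rle_trans; [exact Hk |]. eapply Rle_trans; [exact Hle |].
  assert (Hc : 1 <= a / b) by (apply Rle_div_of_mult; lra).
  set (r := Rmax (norm (hat x)) (norm (hat y))). set (T := edist (hat x) (hat y)).
  assert (HT : 0 <= T) by apply edist_nonneg.
  assert (Hr : r < 1) by (apply Rmax_lub_lt; apply norm_lt_1; assumption).
  set (d := Rmin (dG E x) (dG E y)).
  assert (Hd : 0 < d) by (apply Rmin_glb_lt; apply ellipse_dG_pos; assumption).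
  assert (Hdr : d <= a * (1 - r)).
  { unfold d, r. pose proof (ellipse_dG_le_disc x Hx). pose proof (ellipse_dG_le_disc y Hy).
    pose proof (Rmin_l (dG E x) (dG E y)). pose proof (Rmin_r (dG E x) (dG E y)).
    unfold Rmax. destruct (Rle_dec _ _); lra. }
  assert (Hj : ln (1 + T / (1 - r)) <= a / b * jG E x y).
  { assert (HTr : 0 <= T / (1 - r)) by (apply Rle_div_of_mult; lra).
    eapply Rle_trans; [apply (ln_concave_at_1 (a / b)); [exact Hc | exact HTr] |].
    apply Rmult_le_compat_l; [lra |]. unfold jG. fold d.
    assert (0 <= T / (1 - r) / (a / b)) by (apply Rle_div_of_mult; lra).
    apply ln_le_compat; [lra |].
    apply Rplus_le_compat_l. apply Rle_div_of_mult; [exact Hd |].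
    apply Rle_trans with (b * T); [| apply edist_disc_coord_ge].
    replace (b * T) with (T / (1 - r) / (a / b) * (a * (1 - r))) by (field; lra).
    apply Rmult_le_compat_l; assumption. }
  replace (2 * (a / b) ^ 2 * jG E x y) with (a / b * (2 * (a / b * jG E x y))) by ring.
  apply Rmult_le_compat_l; [lra |]. lra.
Qed.

(** * Lower bounds from one-coordinate majorants of the boundary distance *)

(** The right side is the distance to the nearer tangent line at an end of the minor axis; that line
    misses [E]. *)
Lemma ellipse_dG_le_minor (p : pt) : E p -> dG E p <= b * (1 - Rabs (snd (hat p))).
Proof.
  intros Hp. pose proof (proj1 (ellipse_domain_iff p) Hp) as Hn.
  destruct (hat p) as [u v] eqn:Hhat. unfold normsq in Hn. cbn [fst snd] in *.
  assert (Hv : exists s, s ^ 2 = 1 /\ (v - s) ^ 2 = (1 - Rabs v) ^ 2).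
  { unfold Rabs. destruct (Rcase_abs v); [exists (-1) | exists 1]; split; ring. }
  destruct Hv as [s [Hs Hvs]].
  assert (Rabs v <= 1).
  { apply le_of_sqr_le; [lra |]. rewrite pow2_abs. pose proof (pow2_ge_0 u). lra. }
  eapply Rle_trans; [apply (ellipse_dG_le_outside p (u, s) Hp) |].
  - unfold normsq. cbn [fst snd]. pose proof (pow2_ge_0 u). lra.
  - apply le_of_sqr_le; [apply Rmult_le_pos; lra |].
    rewrite edist_disc_coord, disc_coordK, Hhat. cbn [fst snd].
    rewrite Rpow_mult_distr, Hvs. right. ring.
Qed.

Lemma ellipse_snd_lt_1 (p : pt) : E p -> Rabs (snd (hat p)) < 1.
Proof.
  intros Hp. pose proof (proj1 (ellipse_domain_iff p) Hp) as Hn. unfold normsq in Hn.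
  pose proof (pow2_ge_0 (fst (hat p))). pose proof (pow2_abs (snd (hat p))).
  pose proof (Rabs_pos (snd (hat p))). nra.
Qed.

Lemma ellipse_kG_ge_minor (x y : pt) : E x -> E y ->
  signed_log (snd (hat y)) - signed_log (snd (hat x)) <= kG E x y.
Proof.
  intros Hx Hy. destruct (ellipse_qh_length x y Hx Hy) as [v [Hv _]].
  apply (kG_ge E (fun p => b * (1 - Rabs (snd (hat p))))
               (fun p => signed_log (snd (hat p)))).
  - exists v. exact Hv.
  - exact ellipse_boundary_nonempty.
  - exact ellipse_dG_pos.
  - exact ellipse_dG_le_minor.
  - intros p q _ _. eapply Rle_trans; [| apply edist_disc_coord_snd].
    replace (b * (1 - Rabs (snd (hat p))) - b * (1 - Rabs (snd (hat q))))
      with (b * (Rabs (snd (hat q)) - Rabs (snd (hat p)))) by ring.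
    rewrite Rabs_mult, (Rabs_pos_eq b) by lra. apply Rmult_le_compat_l; [lra |].
    rewrite (Rabs_minus_sym (snd (hat p))). apply Rabs_triang_inv2.
  - intros p q Hp Hq. eapply Rle_trans; [| apply edist_disc_coord_snd].
    rewrite Rmin_mult_distr_l by lra. rewrite Rmult_assoc.
    apply Rmult_le_compat_l; [lra |].
    rewrite (Rabs_minus_sym (snd (hat p))).
    apply signed_log_lipschitz; apply ellipse_snd_lt_1; assumption.
Qed.

Lemma jG_le_ln (G : pt -> Prop) (x y : pt) (l : R) :
  0 < l -> l <= dG G x -> l <= dG G y -> jG G x y <= ln (1 + edist x y / l).
Proof.
  intros Hl Hx Hy. unfold jG. pose proof (edist_nonneg x y).
  assert (Hm : l <= Rmin (dG G x) (dG G y)) by (apply Rmin_glb; assumption).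
  assert (0 <= edist x y / Rmin (dG G x) (dG G y)) by (apply Rle_div_of_mult; lra).
  apply ln_le_compat; [lra |]. apply Rplus_le_compat_l.
  apply Rmult_le_compat_l; [assumption |]. apply Rinv_le_contravar; lra.
Qed.

Lemma ellipse_uniformity_ge_2 (A : R) : uniformity_set E A -> 2 <= A.
Proof.
  intros [HA1 HA]. apply Rnot_lt_le. intros HA2.
  assert (Hln2 : 0 < ln 2) by (rewrite <- ln_1; apply ln_increasing; lra).
  (* The two points below have [k >= 2 * L] and [j <= ln 2 + L]; [L] is chosen so that
     [2 * L > A * (ln 2 + L)]. *)
  set (L := A * ln 2 / (2 - A) + 1).
  assert (HL1 : (2 - A) * L = A * ln 2 + (2 - A)) by (unfold L; field; lra).
  assert (HL : 0 < L) by nra.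
  set (eta := exp (- L)).
  assert (Heta0 : 0 < eta) by apply exp_pos.
  assert (Heta1 : eta < 1) by (unfold eta; rewrite <- exp_0; apply exp_increasing; lra).
  assert (Hlneta : ln eta = - L) by apply ln_exp.
  set (x := unhat (0, - (1 - eta))). set (y := unhat (0, 1 - eta)).
  assert (Hin : forall s, s ^ 2 = (1 - eta) ^ 2 -> E (unhat (0, s))).
  { intros s Hs. apply disc_point_inside. unfold normsq. cbn [fst snd]. rewrite Hs. nra. }
  assert (Hd : forall s, s ^ 2 = (1 - eta) ^ 2 -> b * eta <= dG E (unhat (0, s))).
  { intros s Hs. eapply Rle_trans; [| apply ellipse_dG_ge_disc]. rewrite disc_coordK.
    apply Rmult_le_compat_l; [lra |].
    enough (norm (0, s) <= 1 - eta) by lra.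
    apply le_of_sqr_le; [lra |]. rewrite norm_sqr. unfold normsq. cbn [fst snd].
    rewrite Hs. lra. }
  assert (Hx : E x) by (apply Hin; ring). assert (Hy : E y) by (apply Hin; ring).
  pose proof (ellipse_kG_ge_minor x y Hx Hy) as Hk.
  assert (Hhx : hat x = (0, - (1 - eta))) by apply disc_coordK.
  assert (Hhy : hat y = (0, 1 - eta)) by apply disc_coordK.
  rewrite Hhx, Hhy in Hk. cbn [fst snd] in Hk.
  rewrite signed_log_pos, signed_log_neg in Hk by lra.
  replace (1 - (1 - eta)) with eta in Hk by ring.
  replace (1 + - (1 - eta)) with eta in Hk by ring. rewrite Hlneta in Hk.
  assert (Hxy : edist x y <= 2 * b * (1 - eta)).
  { apply le_of_sqr_le; [nra |]. unfold x, y. rewrite edist_disc_coord, !disc_coordK.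
    cbn [fst snd]. right. ring. }
  assert (Hj : jG E x y <= ln 2 + L).
  { eapply Rle_trans; [apply (jG_le_ln E x y (b * eta)) |].
    - nra.
    - apply Hd. ring.
    - apply Hd. ring.
    - replace (ln 2 + L) with (ln (2 / eta)) by (rewrite ln_div by lra; lra).
      assert (Hq : edist x y / (b * eta) <= 2 * (1 - eta) / eta).
      { replace (2 * (1 - eta) / eta) with (2 * b * (1 - eta) / (b * eta)) by (field; lra).
        apply Rmult_le_compat_r; [left; apply Rinv_0_lt_compat; nra | exact Hxy]. }
      assert (0 <= edist x y / (b * eta)).
      { apply Rle_div_of_mult; [nra |]. rewrite Rmult_0_l. apply edist_nonneg. }
      assert (2 / eta = 1 + 2 * (1 - eta) / eta + 1) by (field; lra).
      apply ln_le_compat; lra. }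
  specialize (HA x y Hx Hy).
  assert (A * jG E x y <= A * (ln 2 + L)) by (apply Rmult_le_compat_l; lra).
  lra.
Qed.

(* [k] is the eccentricity.  The points [(u, 0)] with [|u| <= k^2] (in units of
   [a]) are those whose nearest boundary points are not the vertices on the
   major axis; their distance to the boundary is [b sqrt (1 - u^2 / k^2)]. *)
Definition major_axis_coord (k : R) (p : pt) : R := clamp (k ^ 2) (fst (hat p)) / k.

(** When [k] is the eccentricity, the value beyond the centres of curvature is the constant b^2 / a,
    the radius of curvature at the vertices. *)
Definition major_axis_dist (k : R) (p : pt) : R :=
  b * sqrt (1 - major_axis_coord k p ^ 2).

Lemma major_axis_coord_bound (k : R) (p : pt) : 0 < k ->
  - k <= major_axis_coord k p <= k.
Proof.
  intros Hk. unfold major_axis_coord.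
  pose proof (clamp_bound (k ^ 2) (fst (hat p)) (pow2_ge_0 k)).
  split; [apply Rle_div_of_mult | apply Rdiv_le_of_mult]; lra.
Qed.

Lemma major_axis_coord_lipschitz (k : R) (p q : pt) : 0 < k ->
  a * k * Rabs (major_axis_coord k p - major_axis_coord k q) <= edist p q.
Proof.
  intros Hk. eapply Rle_trans; [| apply edist_disc_coord_fst].
  rewrite Rmult_assoc. apply Rmult_le_compat_l; [lra |].
  eapply Rle_trans; [| apply (clamp_lipschitz (k ^ 2))].
  unfold major_axis_coord. rewrite <- (Rabs_pos_eq k) at 1 by lra.
  rewrite <- Rabs_mult. right. f_equal. field. lra.
Qed.

(* The tangent line at [(u / k^2, v')] misses the ellipse, and its foot from
   [p] lies at distance at most [b sqrt (1 - u^2 / k^2)] when [v v' >= 0]. *)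
Lemma ellipse_dG_le_major (k : R) (p : pt) :
  0 < k < 1 -> b ^ 2 = a ^ 2 * (1 - k ^ 2) -> E p -> dG E p <= major_axis_dist k p.
Proof.
  intros Hk Hab Hp. pose proof (proj1 (ellipse_domain_iff p) Hp) as Hn.
  unfold major_axis_dist, major_axis_coord.
  destruct (hat p) as [u v] eqn:Hhat. unfold normsq in Hn. cbn [fst snd] in *.
  assert (Hk2 : 0 < k ^ 2 < 1) by nra.
  destruct (classic (- k ^ 2 <= u <= k ^ 2)) as [Hu | Hu].
  - rewrite clamp_id by exact Hu.
    set (u' := u / k ^ 2).
    assert (Hu' : u = u' * k ^ 2) by (unfold u'; field; lra).
    assert (Hu'1 : u' ^ 2 <= 1).
    { assert (-1 <= u' <= 1); [| nra].
      split; [apply Rle_div_of_mult | apply Rdiv_le_of_mult]; lra. }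
    assert (Hv' : exists v', v' ^ 2 = 1 - u' ^ 2 /\ 0 <= v * v').
    { pose proof (sqrt_pos (1 - u' ^ 2)) as Hs0.
      assert (Hs : sqrt (1 - u' ^ 2) ^ 2 = 1 - u' ^ 2) by (apply pow2_sqrt; lra).
      destruct (Rle_dec 0 v).
      - exists (sqrt (1 - u' ^ 2)). split; [exact Hs | nra].
      - exists (- sqrt (1 - u' ^ 2)). split; [| nra].
        rewrite <- Rsqr_pow2, <- Rsqr_neg, Rsqr_pow2. exact Hs. }
    destruct Hv' as [v' [Hv' Hvv]].
    replace ((u / k) ^ 2) with (u' * u) by (unfold u'; field; lra).
    set (S2 := 1 - u' * u).
    assert (HS2 : 0 < S2) by (unfold S2; rewrite Hu'; nra).
    set (w := 1 - u * u' - v * v').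
    assert (Hw0 : 0 <= w).
    { unfold w. pose proof (pow2_ge_0 (u - u')). pose proof (pow2_ge_0 (v - v')). nra. }
    assert (Hw1 : w <= S2) by (unfold w, S2; lra).
    set (r := w / S2).
    assert (Hr : r * S2 = w) by (unfold r; field; lra).
    assert (Hr0 : 0 <= r) by (apply Rle_div_of_mult; lra).
    assert (Hr1 : r <= 1) by (apply Rdiv_le_of_mult; lra).
    assert (Hline : u' ^ 2 * (1 - k ^ 2) + v' ^ 2 = S2)
      by (unfold S2; rewrite Hv', Hu'; ring).
    (* The foot of the perpendicular for the metric of the ellipse: its normal direction, in disc
       coordinates, is proportional to (u' / a^2, v' / b^2). *)
    set (z := (u + r * u' * (1 - k ^ 2), v + r * v')).
    eapply Rle_trans; [apply (ellipse_dG_le_outside p z Hp) |].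
    + assert (Hone : fst z * u' + snd z * v' = 1).
      { unfold z. cbn [fst snd].
        transitivity (1 - w + r * (u' ^ 2 * (1 - k ^ 2) + v' ^ 2)); [unfold w; ring |].
        rewrite Hline, Hr. ring. }
      unfold normsq. pose proof (pow2_ge_0 (fst z - u')). pose proof (pow2_ge_0 (snd z - v')).
      nra.
    + apply le_of_sqr_le; [apply Rmult_le_pos; [lra | apply sqrt_pos] |].
      rewrite edist_disc_coord, disc_coordK, Hhat, Rpow_mult_distr, pow2_sqrt by lra.
      unfold z. cbn [fst snd].
      replace (a ^ 2 * (u - (u + r * u' * (1 - k ^ 2))) ^ 2 + b ^ 2 * (v - (v + r * v')) ^ 2)
        with (r ^ 2 * (a ^ 2 * (1 - k ^ 2) * (u' ^ 2 * (1 - k ^ 2)) + b ^ 2 * v' ^ 2)) by ring.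
      rewrite <- Hab, <- Rmult_plus_distr_l, Hline.
      assert (0 <= b ^ 2 * S2) by (apply Rmult_le_pos; [apply pow2_ge_0 | lra]).
      assert (r ^ 2 <= 1) by nra. nra.
  (* Beyond a centre of curvature, the tangent line at the vertex on that side is within b^2 / a of
     [p]. *)
  - assert (Hcl : (clamp (k ^ 2) u / k) ^ 2 = k ^ 2).
    { unfold Rdiv. rewrite Rpow_mult_distr, clamp_outside by (lra || exact Hu). field. lra. }
    rewrite Hcl.
    assert (Hs : exists s, s ^ 2 = 1 /\ (u - s) ^ 2 <= (1 - k ^ 2) ^ 2).
    { assert (u ^ 2 < 1) by (pose proof (pow2_ge_0 v); lra).
      assert (-1 < u < 1) by nra.
      destruct (Rle_dec 0 u); [exists 1 | exists (-1)]; (split; [ring |]).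
      - assert (k ^ 2 < u) by (apply Rnot_le_lt; intros H'; apply Hu; lra). nra.
      - assert (u < - k ^ 2) by (apply Rnot_le_lt; intros H'; apply Hu; lra). nra. }
    destruct Hs as [s [Hs1 Hs2]].
    eapply Rle_trans; [apply (ellipse_dG_le_outside p (s, v) Hp) |].
    + unfold normsq. cbn [fst snd]. pose proof (pow2_ge_0 v). lra.
    + apply le_of_sqr_le; [apply Rmult_le_pos; [lra | apply sqrt_pos] |].
      rewrite edist_disc_coord, disc_coordK, Hhat, Rpow_mult_distr, pow2_sqrt by lra.
      cbn [fst snd]. rewrite Hab.
      replace (a ^ 2 * (1 - k ^ 2) * (1 - k ^ 2)) with (a ^ 2 * (1 - k ^ 2) ^ 2) by ring.
      rewrite Rminus_diag. pose proof (pow2_ge_0 a). nra.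
Qed.

(** With s = u / k the length element along the axis is a k ds, and integrating it against 1 / (b
    sqrt(1 - s^2)) gives the [asin] term. *)
Lemma ellipse_kG_ge_major (k : R) (x y : pt) :
  0 < k < 1 -> b ^ 2 = a ^ 2 * (1 - k ^ 2) -> E x -> E y ->
  a / b * k * asin (major_axis_coord k y) - a / b * k * asin (major_axis_coord k x)
  <= kG E x y.
Proof.
  intros Hk Hab Hx Hy. destruct (ellipse_qh_length x y Hx Hy) as [v [Hv _]].
  assert (Hk2 : 0 < k ^ 2 < 1) by nra.
  apply (kG_ge E (major_axis_dist k)
               (fun p => a / b * k * asin (major_axis_coord k p))).
  - exists v. exact Hv.
  - exact ellipse_boundary_nonempty.
  - exact ellipse_dG_pos.
  - intros p Hp. apply ellipse_dG_le_major; assumption.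
  - intros p q _ _. eapply Rle_trans; [| apply (major_axis_coord_lipschitz k); lra].
    unfold major_axis_dist.
    pose proof (major_axis_coord_bound k p ltac:(lra)) as Hp.
    pose proof (major_axis_coord_bound k q ltac:(lra)) as Hq.
    set (s := major_axis_coord k p) in *. set (s' := major_axis_coord k q) in *.
    (* Clamping to [[-k, k]] keeps the square root at least [b / a]; dividing the difference of
       squares by [S + S'] then yields the Lipschitz bound. *)
    assert (Hsq : forall s, - k <= s <= k -> b <= a * sqrt (1 - s ^ 2)
                                        /\ sqrt (1 - s ^ 2) ^ 2 = 1 - s ^ 2).
    { intros r Hr. assert (r ^ 2 <= k ^ 2) by nra.
      assert (Heq : sqrt (1 - r ^ 2) ^ 2 = 1 - r ^ 2) by (apply pow2_sqrt; lra).
      split; [| exact Heq].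
      apply le_of_sqr_le; [apply Rmult_le_pos; [lra | apply sqrt_pos] |].
      rewrite Rpow_mult_distr, Heq, Hab. apply Rmult_le_compat_l; [apply pow2_ge_0 | lra]. }
    destruct (Hsq s Hp) as [H1 H2]. destruct (Hsq s' Hq) as [H3 H4].
    set (S := sqrt (1 - s ^ 2)) in *. set (S' := sqrt (1 - s' ^ 2)) in *.
    replace (b * S - b * S') with (b * (S - S')) by ring.
    rewrite Rabs_mult, (Rabs_pos_eq b) by lra.
    assert (Hprod : Rabs (S - S') * (S + S') = Rabs (s - s') * Rabs (s + s')).
    { assert (0 <= S) by apply sqrt_pos. assert (0 <= S') by apply sqrt_pos.
      rewrite <- (Rabs_pos_eq (S + S')) by lra.
      rewrite <- !Rabs_mult, <- (Rabs_Ropp ((s - s') * _)). f_equal. lra. }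
    assert (Habs : Rabs (s + s') <= 2 * k) by (apply Rabs_le; lra).
    pose proof (Rabs_pos (S - S')). pose proof (Rabs_pos (s - s')).
    assert (Rabs (S - S') * (2 * b) <= Rabs (S - S') * (a * (S + S')))
      by (apply Rmult_le_compat_l; lra).
    assert (Rabs (s - s') * Rabs (s + s') <= Rabs (s - s') * (2 * k))
      by (apply Rmult_le_compat_l; lra).
    assert (a * (Rabs (s - s') * Rabs (s + s')) <= a * (Rabs (s - s') * (2 * k)))
      by (apply Rmult_le_compat_l; lra).
    rewrite <- Hprod in *. lra.
  - intros p q _ _. eapply Rle_trans; [| apply (major_axis_coord_lipschitz k); lra].
    unfold major_axis_dist.
    pose proof (major_axis_coord_bound k p ltac:(lra)) as Hp.
    pose proof (major_axis_coord_bound k q ltac:(lra)) as Hq.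
    set (s := major_axis_coord k p) in *. set (s' := major_axis_coord k q) in *.
    rewrite Rmin_mult_distr_l by lra.
    replace (b * Rmin (sqrt (1 - s ^ 2)) (sqrt (1 - s' ^ 2))
             * (a / b * k * asin s' - a / b * k * asin s))
      with (a * k * (Rmin (sqrt (1 - s ^ 2)) (sqrt (1 - s' ^ 2)) * (asin s' - asin s)))
      by (field; lra).
    rewrite (Rabs_minus_sym s).
    apply Rmult_le_compat_l; [apply Rmult_le_pos; lra |].
    apply asin_lipschitz; lra.
Qed.

(** The centres of curvature are 2 a k^2 apart and at least b^2 / a from the boundary, whence 1 + 2
    (a^2 - b^2) / b^2 = 2 (a / b)^2 - 1 inside the logarithm. *)
Lemma ellipse_uniformity_ge_major (k A : R) :
  0 < k < 1 -> b ^ 2 = a ^ 2 * (1 - k ^ 2) -> uniformity_set E A ->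
  2 * (a / b * k) * asin k <= A * ln (2 * (a / b) ^ 2 - 1).
Proof.
  intros Hk Hab [HA1 HA].
  assert (Hk2 : 0 < k ^ 2 < 1) by nra.
  set (x := unhat (- k ^ 2, 0)). set (y := unhat (k ^ 2, 0)).
  assert (Hin : forall s, s ^ 2 = (k ^ 2) ^ 2 -> E (unhat (s, 0))).
  { intros s Hs. apply disc_point_inside. unfold normsq. cbn [fst snd]. rewrite Hs. nra. }
  assert (Hd : forall s, s ^ 2 = 1 -> b * (b / a) <= dG E (unhat (s * k ^ 2, 0))).
  { intros s Hs. apply ellipse_dG_ge. intros z Hz.
    apply le_of_sqr_le; [apply edist_nonneg |].
    rewrite edist_disc_coord, disc_coordK. destruct (hat z) as [u v].
    unfold normsq in Hz. cbn [fst snd] in *.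
    replace ((b * (b / a)) ^ 2) with (b ^ 2 * b ^ 2 / a ^ 2) by (field; lra).
    rewrite Hab.
    replace (a ^ 2 * (1 - k ^ 2) * (a ^ 2 * (1 - k ^ 2)) / a ^ 2)
      with (a ^ 2 * (1 - k ^ 2) ^ 2) by (field; lra).
    rewrite Rmult_assoc, <- Rmult_plus_distr_l.
    apply Rmult_le_compat_l; [apply pow2_ge_0 |].
    assert ((1 - k ^ 2) * (1 - u ^ 2) <= (1 - k ^ 2) * v ^ 2)
      by (apply Rmult_le_compat_l; lra).
    assert (0 <= k ^ 2 * (u - s) ^ 2) by (apply Rmult_le_pos; [lra | apply pow2_ge_0]).
    (* The square completes exactly at a centre of curvature: the circle of curvature at the vertex
       lies in the closed ellipse. The last term vanishes by [s ^ 2 = 1]. *)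
    assert ((s * k ^ 2 - u) ^ 2 + (1 - k ^ 2) * (1 - u ^ 2)
            = k ^ 2 * (u - s) ^ 2 + (1 - k ^ 2) ^ 2 + (s ^ 2 - 1) * (k ^ 2 * k ^ 2 - k ^ 2))
      by ring.
    rewrite Hs in *. replace ((0 - v) ^ 2) with (v ^ 2) by ring. lra. }
  assert (Hx : E x) by (apply Hin; ring). assert (Hy : E y) by (apply Hin; ring).
  pose proof (ellipse_kG_ge_major k x y Hk Hab Hx Hy) as Hkg.
  assert (Hcx : major_axis_coord k x = - k).
  { unfold major_axis_coord, x. rewrite disc_coordK. cbn [fst].
    rewrite clamp_id by lra. field. lra. }
  assert (Hcy : major_axis_coord k y = k).
  { unfold major_axis_coord, y. rewrite disc_coordK. cbn [fst].
    rewrite clamp_id by lra. field. lra. }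
  rewrite Hcx, Hcy, asin_opp in Hkg.
  assert (Hxy : edist x y <= 2 * a * k ^ 2).
  { apply le_of_sqr_le; [nra |]. unfold x, y. rewrite edist_disc_coord, !disc_coordK.
    cbn [fst snd]. right. ring. }
  assert (Hba : 0 < b * (b / a)) by (apply Rmult_lt_0_compat; [lra | apply Rdiv_lt_0_compat; lra]).
  assert (Hj : jG E x y <= ln (2 * (a / b) ^ 2 - 1)).
  { eapply Rle_trans; [apply (jG_le_ln E x y (b * (b / a)) Hba) |].
    - replace x with (unhat (-1 * k ^ 2, 0)) by (unfold x; f_equal; f_equal; ring).
      apply Hd. ring.
    - replace y with (unhat (1 * k ^ 2, 0)) by (unfold y; f_equal; f_equal; ring).
      apply Hd. ring.
    - assert (0 <= edist x y / (b * (b / a))).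
      { apply Rle_div_of_mult; [exact Hba |]. rewrite Rmult_0_l. apply edist_nonneg. }
      apply ln_le_compat; [lra |].
      enough (edist x y / (b * (b / a)) <= 2 * (a / b) ^ 2 - 2) by lra.
      apply Rdiv_le_of_mult; [exact Hba |].
      replace ((2 * (a / b) ^ 2 - 2) * (b * (b / a))) with (2 * (a ^ 2 - b ^ 2) / a)
        by (field; lra).
      rewrite Hab. eapply Rle_trans; [exact Hxy |]. right. field. lra. }
  specialize (HA x y Hx Hy).
  assert (A * jG E x y <= A * ln (2 * (a / b) ^ 2 - 1)) by (apply Rmult_le_compat_l; lra).
  lra.
Qed.

End Ellipse.

(* A_E is finite and equals A; 2 <= A, second lower bound when c > 1, A <= 2c^4. *)
Theorem theorem1p9 (a b x0 y0 th : R) (hb : 0 < b) (hab : b <= a) :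
  let c := a / b in
  exists A : R,
    is_glb (uniformity_set (ellipse_domain a b x0 y0 th)) A /\
    2 <= A /\
    (1 < c ->
       2 * sqrt (c ^ 2 - 1) * asin (sqrt (1 - 1 / c ^ 2)) / ln (2 * c ^ 2 - 1) <= A) /\
    A <= 2 * c ^ 4.
Proof.
  intros c.
  set (E := ellipse_domain a b x0 y0 th).
  assert (Hc : 1 <= c) by (apply Rle_div_of_mult; lra).
  assert (Hc2 : 1 <= c ^ 2) by nra.
  assert (Hmem : uniformity_set E (2 * c ^ 2)).
  { split; [lra |]. intros x y Hx Hy. apply ellipse_kG_le; assumption. }
  destruct (glb_exists (uniformity_set E) 1) as [A HA].
  - exists (2 * c ^ 2). exact Hmem.
  - intros A [H _]. exact H.
  - exists A. split; [exact HA |]. split; [| split].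
    + apply HA. intros A' HA'. exact (ellipse_uniformity_ge_2 _ _ _ _ _ hb hab A' HA').
    + intros Hc1. apply HA. intros A' HA'.
      assert (Hcc : 1 < c ^ 2) by nra.
      assert (Hinv : 0 < 1 / c ^ 2 < 1).
      { split; [apply Rdiv_lt_0_compat; lra |].
        apply Rmult_lt_reg_r with (c ^ 2); [lra |].
        unfold Rdiv. rewrite Rmult_assoc, Rinv_l by lra. lra. }
      (* The eccentricity; [c * k] is the factor [sqrt (c ^ 2 - 1)] of the statement. *)
      set (k := sqrt (1 - 1 / c ^ 2)).
      assert (Hksq : k ^ 2 = 1 - 1 / c ^ 2) by (apply pow2_sqrt; lra).
      assert (Hk : 0 < k < 1).
      { split; [apply sqrt_lt_R0; lra |].
        rewrite <- sqrt_1. apply sqrt_lt_1; lra. }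
      assert (Hab : b ^ 2 = a ^ 2 * (1 - k ^ 2)).
      { rewrite Hksq. unfold c. field. split; lra. }
      assert (Hck : sqrt (c ^ 2 - 1) = c * k).
      { rewrite <- (sqrt_pow2 (c * k)) by nra. f_equal.
        rewrite Rpow_mult_distr, Hksq. field. lra. }
      rewrite Hck. apply Rdiv_le_of_mult.
      * rewrite <- ln_1. apply ln_increasing; lra.
      * exact (ellipse_uniformity_ge_major _ _ x0 y0 th hb hab k A' Hk Hab HA').
    + apply Rle_trans with (2 * c ^ 2); [apply HA; exact Hmem |].
      replace (c ^ 4) with (c ^ 2 * c ^ 2) by ring. nra.
Qed.
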